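(* Let $0<\beta<\alpha\le1$, let $a,b>0$, and let $g:[0,\infty)\to\mathbb R$ be a continuous function of the form $$g(t)={}^CD^\alpha_{0^+}\big[(t+1)^\sigma h(t)\big],\quad t\in[0,\infty),$$ where $\alpha-\beta<\sigma<\alpha\le1$, $h$ is continuously differentiable and bounded on $[0,\infty)$, $\limsup_{t\to\infty}h(t)>0$, $\liminf_{t\to\infty}h(t)<0$, and $h'(t)=O(t^\eta)$ as $t\to\infty$ for some $\eta$ with $-1<\eta<\alpha-\sigma-1$. Then, for $x_0\in\mathbb R$, an arbitrary nontrivial solution $x$ of $${}^CD^\alpha_{0^+}x(t)+a\,{}^CD^\beta_{0^+}x(t)=-b\,x(t)+g(t),\quad t>0,\qquad x(0)=x_0,$$ is oscillatory, and $$x(t)=O\big(t^{\max\{-\beta,\ \eta+\sigma-\alpha+1\}}\big)\quad\text{as }t\to\infty.$$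
   Context: For $0<\alpha\le1$ and $f:[0,\infty)\to\mathbb R$: $I^\alpha_{0^+}f(t)=\frac1{\Gamma(\alpha)}\int_0^t(t-s)^{\alpha-1}f(s)\,ds$, $I^0_{0^+}f=f$, and the Caputo derivative is ${}^CD^\alpha_{0^+}f(t)=\frac{d}{dt}I^{1-\alpha}_{0^+}(f-f(0))(t)$ for $t>0$ (its value at $t=0$ understood by continuous extension). A function $f\in C[0,\infty)$ is continuously Caputo $\alpha$-differentiable on $[0,\infty)$ if ${}^CD^\alpha_{0^+}f$ exists and is continuous on $[0,\infty)$. A solution is a continuously Caputo $\alpha$-differentiable function $x:[0,\infty)\to\mathbb R$ satisfying the equation on $(0,\infty)$ and the initial condition. A solution $x$ is oscillatory if it exists globally on $[0,\infty)$ and there is a sequence $t_k\in[0,\infty)$ with $t_k\to\infty$ and $x(t_k)=0$ for all $k$. *)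

(* Defs.v *)
From HB Require Import structures.
From mathcomp Require Import all_boot all_order all_algebra.
From mathcomp Require Import all_classical all_reals all_analysis.

Set Implicit Arguments.
Unset Strict Implicit.
Unset Printing Implicit Defensive.

Import Order.TTheory GRing.Theory Num.Theory.
Import numFieldNormedType.Exports.

Local Open Scope classical_set_scope.
Local Open Scope ring_scope.

(* Functions on [0, +oo[ are represented by total functions R -> R; nothing
   below depends on their values at negative reals. *)

(* Lets the Landau notations be used at +oo. *)
Canonical pinfty_filter_on (R : numFieldType) :=
  FilterType (pinfty_nbhs R) _.

Definition Gamma (R : realType) (z : R) : R :=
  \int[@lebesgue_measure R]_(t in `[0, +oo[) (t `^ (z - 1) * expR (- t)).

(* Riemann-Liouville integral based at 0. The value 0 `^ (alpha - 1) taken by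
   the library at the endpoint s = t only affects a null set. *)
Definition frac_int (R : realType) (alpha : R) (f : R -> R) (t : R) : R :=
  if alpha == 0 then f t
  else (Gamma alpha)^-1 *
    \int[@lebesgue_measure R]_(s in `[0, t]) ((t - s) `^ (alpha - 1) * f s).

Definition caputo_prim (R : realType) (alpha : R) (f : R -> R) : R -> R :=
  frac_int (1 - alpha) (fun s => f s - f 0).

Definition caputo_derivable (R : realType) (alpha : R) (f : R -> R) (t : R) :
  Prop := derivable (caputo_prim alpha f) t 1.

(* The value at 0 is that of the continuous extension from the right; like
   derive1, it is meaningful only where the derivative (resp. limit) exists. *)
Definition caputo (R : realType) (alpha : R) (f : R -> R) (t : R) : R :=
  if 0 < t then derive1 (caputo_prim alpha f) t
  else lim (derive1 (caputo_prim alpha f) s @[s --> 0^'+]).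

(* Continuity at 0 of [caputo alpha f] forces the limit defining its value
   there to exist. *)
Definition cont_caputo_diff (R : realType) (alpha : R) (f : R -> R) : Prop :=
  [/\ {within `[0, +oo[, continuous f},
      forall t, 0 < t -> caputo_derivable alpha f t &
      {within `[0, +oo[, continuous (caputo alpha f)}].

(* [dh] is the derivative of [h] on [0, +oo[, one-sided at 0. *)
Definition derivative_on_halfline (R : realType) (h dh : R -> R) : Prop :=
  forall t, 0 <= t ->
    (h s - h t) / (s - t) @[s --> within `[0, +oo[ t^'] --> dh t.

(* The last clause includes the existence of both Caputo derivatives at every
   t > 0, since [caputo] is total; the one of order alpha is already contained
   in [cont_caputo_diff]. *)
Definition is_solution (R : realType) (alpha beta a b x0 : R) (g x : R -> R) :
  Prop :=
  [/\ cont_caputo_diff alpha x,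
      x 0 = x0 &
      forall t, 0 < t ->
        caputo_derivable beta x t /\
        caputo alpha x t + a * caputo beta x t = - b * x t + g t].

Definition oscillatory (R : realType) (x : R -> R) : Prop :=
  exists u : nat -> R,
    [/\ forall k, 0 <= u k, u k @[k --> \oo] --> +oo &
        forall k, x (u k) = 0].

(* Main.v *)
Require Import Defs.
From HB Require Import structures.
From mathcomp Require Import all_boot all_order all_algebra.
From mathcomp Require Import all_classical all_reals all_analysis.
From mathcomp Require Import measurable_realfun ring lra.
Import Order.TTheory GRing.Theory Num.Theory.
Import numFieldNormedType.Exports.
Set Implicit Arguments.
Unset Strict Implicit.
Unset Printing Implicit Defensive.
Local Open Scope classical_set_scope.
Local Open Scope ring_scope.

(** Write F(t) = (t + 1)^sigma h(t), and I^p for the Riemann-Liouville integral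
    of order p. Each Caputo derivative is the derivative of a fractional integral,
    so the equation can be integrated once. With X = x - x(0) this gives
    ([integrated_equation])

      I^(1-alpha) X + a I^(1-beta) X + b I^1 x = I^(1-alpha) (F - F(0)),

    in which no derivative of x occurs. Both claims follow from this identity.

    Decay. As eta > -1 and sigma > alpha - beta, the exponent
    max(-beta, eta + sigma - alpha + 1) is its second entry, - gam with
    0 < gam < beta. Suppose for a moment that x is differentiable. Then the
    equation reads I^(1-alpha) x' + a I^(1-beta) x' + b x = I^(1-alpha) F', and it
    obeys a comparison principle ([comparison]): at a negative minimum of x over
    [0, t] attained at t the fractional terms are nonpositive
    ([rl_nonpos_at_min]). The forcing is O(t^(-gam)), because
    F' = O(t^(sigma + eta)) ([forcing_derivative], [forcing_bound]), and
    K (M + t)^(-gam) is a supersolution for M and K large ([supersolution]), since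
    each fractional derivative of (M + t)^(-gam) is at most this power times a
    negative power of M ([conv_shifted_power], [rl_deriv_shifted_power]). Hence
    |x(t)| <= K (M + t)^(-gam). A solution need not be differentiable, so the
    argument is run on its means over windows of length e, which are, with
    constants independent of e ([mean_bound]); then e tends to 0
    ([solution_decay]).

    Oscillation. Otherwise x has no zero after some T, and by linearity it may be
    taken positive there. Applying I^alpha to the identity and using the semigroup
    law ([conv_conv]) gives ([inverted_equation])

      C1 I^1 (X - F + F(0)) + C2 I^(1+alpha-beta) X + C3 I^(1+alpha) x = 0

    with C1 > 0 and C2, C3 >= 0, where the constants are those of unnormalised
    integrals. The last two kernels are nondecreasing, so after T the last two
    terms decrease at most linearly, up to the term in x(0)
    ([conv_nonneg_tail]). Differentiating, F >= - C (1 + t^(alpha-beta))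
    ([forcing_lower_bound]). Since sigma > alpha - beta, dividing by (t + 1)^sigma
    gives liminf h >= 0, contrary to the hypothesis; the negative case contradicts
    limsup h > 0 in the same way. *)

(** * Changes of variables and primitives on open intervals *)

(** The measure structure on a pushforward carries the proof that the map is
    measurable; hiding it behind an existential lets later proofs work with the
    change of variables formula alone. *)
Lemma pushforward_measure (R : realType) (phi : R -> R) :
  measurable_fun [set: R] phi ->
  exists nu : {measure set (measurableTypeR R) -> \bar R},
    (forall A, nu A = @lebesgue_measure R (phi @^-1` A)) /\
    (forall f : R -> \bar R, measurable_fun [set: R] f ->
      (forall x, (0 <= f x)%E) ->
      (\int[nu]_x f x = \int[@lebesgue_measure R]_x f (phi x))%E).
Proof.
move=> mphi.
unshelve eexists.
  unshelve refine (pushforward (@lebesgue_measure R)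
    (phi : measurableTypeR R -> measurableTypeR R)).
  exact: mphi.
split=> //= f mf f0.
by rewrite ge0_integral_pushforward.
Qed.

Lemma ge0_integral_affine (R : realType) (c d : R) (f : R -> \bar R) :
  0 < c -> measurable_fun [set: R] f -> (forall x, (0 <= f x)%E) ->
  (\int[@lebesgue_measure R]_x f x =
   c%:E * \int[@lebesgue_measure R]_x f (c * x + d)%R)%E.
Proof.
move=> c0 mf f0.
pose phi := (fun x => c * x + d) : R -> R.
have mphi : measurable_fun [set: R] phi.
  by apply: measurable_funD => //; exact: measurable_funM.
have [nu [nuE nuint]] := pushforward_measure mphi.
pose c' : {nonneg R} := NngNum (ltW c0).
transitivity (\int[mscale c' nu]_x f x)%E.
  apply: eq_measure_integral => A mA _ /=.
  apply: lebesgue_measure_unique => //= _ [[a b]] _ <- /=.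
  rewrite /mscale /= nuE.
  have -> : phi @^-1` `]a, b] = `](a - d) / c, (b - d) / c]%classic.
    apply/seteqP; split => x /=; rewrite !in_itv/= /phi ltr_pdivrMr// ler_pdivlMr//
      ltrBlDr lerBrDr ![x * c]mulrC; exact.
  rewrite !lebesgue_measure_itv/= !lte_fin.
  rewrite ltr_pM2r ?invr_gt0// ltrD2r.
  case: ifPn => _; last by rewrite mule0.
  rewrite -!EFinD -EFinM; congr EFin; field.
  by rewrite gt_eqF.
by rewrite ge0_integral_mscale// nuint.
Qed.

Lemma integral_translation (R : realType) (d : R) (f : R -> R) :
  measurable_fun [set: R] f ->
  (\int[@lebesgue_measure R]_x (f x)%:E =
   \int[@lebesgue_measure R]_x (f (x + d))%:E)%E.
Proof.
move=> mf; have mf' : measurable_fun [set: R] (EFin \o f) by exact/measurable_EFinP.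
rewrite integralE [RHS]integralE; congr (_ - _)%E.
  rewrite (@ge0_integral_affine R 1 d)//; last exact: measurable_funepos.
  by rewrite mul1e; apply: eq_integral => x _; rewrite funeposE [RHS]funeposE mul1r.
rewrite (@ge0_integral_affine R 1 d)//; last exact: measurable_funeneg.
by rewrite mul1e; apply: eq_integral => x _; rewrite funenegE [RHS]funenegE mul1r.
Qed.

(** Differentiability is required only inside the interval because the
    integrands of interest, u^(p-1) with p < 1, blow up at an endpoint. The
    formula holds on the compact intervals with endpoints a + dl n and b - dl n,
    and monotone convergence takes it to the limit. *)
Lemma ge0_FTC_oo (R : realType) (f F : R -> R) (a b : R) : a < b ->
  (forall x, a < x < b -> 0 <= f x) ->
  (forall x, a < x < b -> {for x, continuous f}) ->
  (forall x, a < x < b -> is_derive x 1 F (f x)) ->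
  F x @[x --> a^'+] --> F a -> F x @[x --> b^'-] --> F b ->
  (\int[@lebesgue_measure R]_(x in `]a, b[) (f x)%:E = (F b - F a)%:E)%E.
Proof.
move=> ab f0 cf dF Fa Fb.
pose dl (n : nat) : R := (b - a) / 3 / n.+1%:R.
have ba : 0 < b - a by rewrite subr_gt0.
have dl0 n : 0 < dl n by rewrite !divr_gt0.
have dl3 n : dl n <= (b - a) / 3.
  by rewrite ler_piMr// ?invr_le1 ?unitfE// ?ler1n// divr_ge0// ltW.
have dl2 n : a + dl n < b - dl n by have := dl3 n; lra.
have dldecr n m : (n <= m)%N -> dl m <= dl n.
  by move=> nm; rewrite ler_pM2l ?divr_gt0// lef_pV2 ?posrE// ler_nat.
have dlcvg : dl n @[n --> \oo] --> 0.
  by rewrite -(mulr0 ((b - a) / 3)); apply: cvgMr; exact: cvg_harmonic.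
pose S : nat -> set R := fun n => `[a + dl n, b - dl n]%classic.
have Sin n x : S n x -> a < x < b.
  by rewrite /S /= in_itv/= => /andP[h1 h2]; have := dl0 n; lra.
have SE : `]a, b[%classic = \bigcup_n S n.
  apply/seteqP; split => x /=.
    rewrite in_itv/= => /andP[ax xb].
    have m0 : 0 < Num.min (x - a) (b - x) by rewrite lt_min !subr_gt0 ax.
    have /cvgrPdist_lt /(_ _ m0) [N _ /(_ N (leqnn N))] := dlcvg.
    rewrite /= sub0r normrN gtr0_norm// lt_min => /andP[h1 h2].
    by exists N => //; rewrite /S /= in_itv/=; lra.
  by case=> n _ /Sin; rewrite in_itv.
have FS n : (\int[@lebesgue_measure R]_(x in S n) (f x)%:E =
    (F (b - dl n))%:E - (F (a + dl n))%:E)%E.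
  have sub x : x \in `]a + dl n, b - dl n[%R -> a < x < b.
    by rewrite in_itv/= => /andP[h1 h2]; have := dl0 n; lra.
  have Fc x : a < x < b -> {for x, continuous F}.
    move=> xab; apply: differentiable_continuous.
    by apply/derivable1_diffP; have [] := dF x xab.
  have e1 : a < a + dl n < b by have := dl0 n; have := dl2 n; lra.
  have e2 : a < b - dl n < b by have := dl0 n; have := dl2 n; lra.
  apply: continuous_FTC2 => //.
  - apply: continuous_in_subspaceT => x /set_mem xS; apply: cf.
    exact: (Sin n).
  - split => [x /sub xab||].
    + by have [] := dF x xab.
    + exact/cvg_at_right_filter/Fc.
    + exact/cvg_at_left_filter/Fc.
  - by move=> x /sub xab; rewrite derive1E; have [] := dF x xab.
have cS : (\int[@lebesgue_measure R]_(x in S i) (f x)%:E)%E @[i --> \oo] -->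
    (\int[@lebesgue_measure R]_(x in `]a, b[) (f x)%:E)%E.
  rewrite SE; apply: (@ge0_nondecreasing_set_cvg_integral _ (measurableTypeR R) R S
    (EFin \o f) (@lebesgue_measure R)).
  - move=> n m nm; apply/subsetPset => x; rewrite /S /= !in_itv/=.
    by have := dldecr _ _ nm; lra.
  - by move=> i; exact: measurable_itv.
  - move=> i; apply/measurable_EFinP; apply: subspace_continuous_measurable_fun; first exact: measurable_itv.
    apply: continuous_in_subspaceT => x /set_mem xS; apply: cf.
    exact: (Sin i).
  - by move=> i x /Sin xab; rewrite lee_fin f0.
have cF : ((F (b - dl n))%:E - (F (a + dl n))%:E)%E @[n --> \oo] --> (F b - F a)%:E.
  under eq_fun do rewrite -EFinB.
  apply: cvg_EFin; first by apply: nearW.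
  apply: cvgB.
    move/cvg_at_leftP : Fb; apply; split; first by move=> n; have := dl0 n; lra.
    by rewrite -[X in _ --> X](subr0 b); apply: cvgB => //; exact: cvg_cst.
  move/cvg_at_rightP : Fa; apply; split; first by move=> n; have := dl0 n; lra.
  by rewrite -[X in _ --> X](addr0 a); apply: cvgD => //; exact: cvg_cst.
move: cS; under eq_fun do rewrite FS; move=> cS.
exact: (cvg_unique _ cS cF).
Qed.

(** * The Abel kernel and convolution with causal functions *)

Section kernel.
Context {R : realType}.
Implicit Types (p q t s u : R) (f g : R -> R).
Local Notation mu := (@lebesgue_measure R).

(** Giving the kernel the value 0 for u <= 0 turns the integral over [0, t] into
    a convolution over the whole line, so that translations and Tonelli's theorem
    apply without changing the domain of integration. *)
Definition ker p u : R := if 0 < u then u `^ (p - 1) else 0.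

Definition conv p f t : R := \int[mu]_s (ker p (t - s) * f s).

(** Local boundedness rather than continuity: the class has to contain the unit
    step and truncations, and to be stable under convolution with the kernel. *)
Definition causal f : Prop :=
  [/\ measurable_fun [set: R] f, forall s, s < 0 -> f s = 0 &
      forall T, exists M, forall s, s <= T -> `|f s| <= M].

Lemma ker_ge0 p u : 0 <= ker p u.
Proof. by rewrite /ker; case: ifP => // _; exact: powR_ge0. Qed.

Lemma ker_le0 p u : u <= 0 -> ker p u = 0.
Proof. by move=> u0; rewrite /ker ltNge u0. Qed.

Lemma ker_gt0 p u : 0 < u -> ker p u = u `^ (p - 1).
Proof. by move=> u0; rewrite /ker u0. Qed.

Lemma measurable_ker p : measurable_fun [set: R] (ker p).
Proof. by apply: measurable_fun_ifT => //; exact: measurable_fun_ltr. Qed.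

Lemma measurable_ker_shift p t : measurable_fun [set: R] (fun s => ker p (t - s)).
Proof.
apply: (@measurableT_comp _ _ _ _ _ _ (ker p)); first exact: measurable_ker.
exact: measurable_funB.
Qed.

Lemma is_derive_powR_sub p t s : s < t ->
  is_derive (s : R) 1 (fun x : R => (t - x) `^ p) (- (p * (t - s) `^ (p - 1))).
Proof.
rewrite -subr_gt0 => ts; have h := is_derive1_powR p ts.
have h' : is_derive (s : R) (1 : R) (fun x : R => t - x) (-1).
  by rewrite -[-1]sub0r; exact: is_deriveB.
have := @is_derive1_comp R (fun y => y `^ p) (fun x : R => t - x) s _ _ h h'.
by rewrite /comp mulrN1.
Qed.

Lemma continuous_powR_sub p t s : s < t ->
  {for s, continuous (fun x : R => (t - x) `^ p)}.
Proof.
move=> st; apply: differentiable_continuous; apply/derivable1_diffP.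
by have [] := is_derive_powR_sub p st.
Qed.

Lemma cvg_powR_sub0 p t : 0 < p -> (t - (x : R)) `^ p @[x --> t^'-] --> (0 : R).
Proof.
move=> p0; apply/cvg_at_leftP => u [ut cu].
have /cvg_at_rightP := @powR_cvg0 R p p0; apply; split.
  by move=> n; rewrite subr_gt0.
by rewrite -(subrr t); apply: cvgB => //; exact: cvg_cst.
Qed.

Lemma integral_ker_window p a t : 0 < p -> a <= t ->
  (\int[mu]_(s in `]a, t[) (ker p (t - s))%:E = ((t - a) `^ p / p)%:E)%E.
Proof.
move=> p0; rewrite le_eqVlt => /predU1P[->|at_].
  by rewrite set_itvoo0 integral_set0 subrr powR0 ?gt_eqF// mul0r.
pose F s := - ((t - s) `^ p / p).
transitivity (\int[mu]_(s in `]a, t[) ((t - s) `^ (p - 1))%:E)%E.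
  apply: eq_integral => s; rewrite inE/= in_itv/= => /andP[_ st].
  by rewrite ker_gt0// subr_gt0.
have FE : F = (fun s => (- p^-1) *: ((fun x => (t - x) `^ p) s)).
  by apply/funext => s /=; rewrite /F -[RHS]/(- p^-1 * _) mulNr mulrC.
transitivity (F t - F a)%:E; first apply: ge0_FTC_oo => //; last first.
- by rewrite /F opprK subrr powR0 ?gt_eqF// mul0r oppr0 add0r.
- rewrite {2}/F subrr powR0 ?gt_eqF// mul0r oppr0 FE -(scaler0 (R^o) (- p^-1)).
  by apply: cvgZr; exact: cvg_powR_sub0.
- apply: cvg_at_right_filter; apply: differentiable_continuous.
  apply/derivable1_diffP; rewrite FE; apply: derivableZ.
  by have [] := is_derive_powR_sub p at_.
- move=> x /andP[ax xt]; have h := is_derive_powR_sub p xt.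
  rewrite FE; apply: is_derive_eq.
  by rewrite -[LHS]/(- p^-1 * - _) mulrNN mulrA mulVf ?mul1r// gt_eqF.
- by move=> x /andP[ax xt]; exact: continuous_powR_sub.
- by move=> x _; exact: powR_ge0.
Qed.

Definition ext f s : R := if 0 <= s then f s else 0.

Lemma ext_ge0 f s : 0 <= s -> ext f s = f s.
Proof. by rewrite /ext => ->. Qed.

Lemma ext_lt0 f s : s < 0 -> ext f s = 0.
Proof. by rewrite /ext ltNge; case: ifP. Qed.

(** The convolution with the unit step is the majorant from which every other
    integrability statement is deduced. *)
Lemma integral_ker_unit p t : 0 < p -> 0 <= t ->
  (\int[mu]_s (ker p (t - s) * ext (cst 1) s)%:E = (t `^ p / p)%:E)%E.
Proof.
move=> p0 t0; rewrite -[in RHS](subr0 t) -integral_ker_window//.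
rewrite integral_itv_obnd_cbnd; last first.
  by apply/measurable_EFinP; apply: measurable_funS (measurable_ker_shift p t).
rewrite [RHS]integral_mkcond; apply: eq_integral => s _.
rewrite patchE mem_setE in_itv/= /ext.
case: (leP 0 s) => s0 /=; last by rewrite mulr0.
by case: ltP => st; rewrite mulr1//= ker_le0// subr_le0.
Qed.

Lemma causal_bound f T : causal f ->
  exists2 M, 0 <= M & forall s, s <= T -> `|f s| <= M.
Proof.
by case=> _ _ /(_ T)[M fM]; exists M => //; exact: le_trans (fM T _).
Qed.

Lemma measurable_ext f : {within `[0, +oo[, continuous f} -> measurable_fun [set: R] (ext f).
Proof.
move=> cf.
have -> : ext f = f \_ `[0, +oo[.
  by apply/funext => s; rewrite patchE mem_setE in_itv/= andbT.
apply/(measurable_restrictT _ _).1 => //.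
exact: subspace_continuous_measurable_fun.
Qed.

Lemma ext_causal f : {within `[0, +oo[, continuous f} -> causal (ext f).
Proof.
move=> cf; split; first exact: measurable_ext.
  by move=> s; exact: ext_lt0.
move=> T.
have [T0|T0] := ltP T 0.
  by exists 0 => s sT; rewrite ext_lt0 ?normr0// (le_lt_trans sT).
have cT : {within `[0, T], continuous f}.
  apply: continuous_subspaceW cf => x /=; rewrite !in_itv/= andbT.
  by case/andP.
have [M [_ fM]] := compact_bounded (continuous_compact cT (@segment_compact _ 0 T)).
exists (Num.max 0 (M + 1)) => s sT.
have [s0|s0] := ltP s 0; first by rewrite ext_lt0// normr0 le_max lexx.
rewrite ext_ge0// le_max (fM (M + 1)) ?orbT// ?ltrDl//.
by exists s => //=; rewrite in_itv/= s0.
Qed.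

Lemma ext1_causal : causal (ext (cst 1)).
Proof. by apply: ext_causal; apply: continuous_subspaceT => x; exact: cst_continuous. Qed.

Lemma integrable_ker_unit p t : 0 < p ->
  mu.-integrable setT (fun s => (ker p (t - s) * ext (cst 1) s)%:E).
Proof.
move=> p0; apply/integrableP; split.
  apply/measurable_EFinP; apply: measurable_funM.
    exact: measurable_ker_shift.
  by have [] := ext1_causal.
under eq_integral => s _.
  rewrite /= ger0_norm; last by rewrite mulr_ge0// ?ker_ge0// /ext; case: ifP.
  over.
have [t0|t0] := ltP t 0; last by rewrite integral_ker_unit// ltry.
rewrite integral0_eq ?ltry// => s _; rewrite /ext; case: ifP; rewrite ?mulr0// => s0.
by rewrite ker_le0 ?mul0r// subr_le0 ltW// (lt_le_trans t0).
Qed.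

Lemma ker_causal_le p f t M s : causal f -> (forall s, s <= t -> `|f s| <= M) ->
  `|ker p (t - s) * f s| <= M * (ker p (t - s) * ext (cst 1) s).
Proof.
move=> [_ f0 _] fM; have [s0|s0] := ltP s 0.
  by rewrite f0// ext_lt0// !mulr0 normr0.
rewrite ext_ge0// mulr1; have [st|ts] := leP s t.
  by rewrite normrM ger0_norm ?ker_ge0// mulrC ler_wpM2r// ?ker_ge0// fM.
by rewrite ker_le0 ?mul0r ?mulr0 ?normr0// subr_le0 ltW.
Qed.

Lemma conv_integrable p f t : 0 < p -> causal f ->
  mu.-integrable setT (fun s => (ker p (t - s) * f s)%:E).
Proof.
move=> p0 cf; have [mf f0 _] := cf.
have [M M0 fM] := causal_bound t cf.
apply: le_integrable (integrableZl measurableT M (integrable_ker_unit t p0)) => //.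
  apply/measurable_EFinP; apply: measurable_funM => //.
  exact: measurable_ker_shift.
move=> s _ /=; rewrite lee_fin.
by apply: le_trans (ler_norm _); exact: ker_causal_le.
Qed.

Lemma conv_unit p t : 0 < p -> 0 <= t -> conv p (ext (cst 1)) t = t `^ p / p.
Proof. by move=> p0 t0; rewrite /conv /Rintegral integral_ker_unit. Qed.

Lemma conv_le0 p f t : causal f -> t <= 0 -> conv p f t = 0.
Proof.
move=> [_ f0 _] t0; rewrite /conv /Rintegral integral0_eq// => s _.
have [s0|s0] := ltP s 0; first by rewrite f0// mulr0.
by rewrite ker_le0 ?mul0r// subr_le0 (le_trans t0).
Qed.

Lemma convD p f g t : 0 < p -> causal f -> causal g ->
  conv p (fun s => f s + g s) t = conv p f t + conv p g t.
Proof.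
move=> p0 cf cg; rewrite /conv -RintegralD//; try exact: conv_integrable.
by apply: eq_Rintegral => s _; rewrite mulrDr.
Qed.

Lemma convZ p f c t : 0 < p -> causal f ->
  conv p (fun s => c * f s) t = c * conv p f t.
Proof.
move=> p0 cf; rewrite /conv -RintegralZl//; last exact: conv_integrable.
by apply: eq_Rintegral => s _; rewrite mulrCA.
Qed.

Lemma causalD f g : causal f -> causal g -> causal (fun s => f s + g s).
Proof.
move=> [mf f0 fb] [mg g0 gb]; split; first exact: measurable_funD.
  by move=> s s0; rewrite f0// g0// addr0.
move=> T; have [M fM] := fb T; have [N gN] := gb T; exists (M + N) => s sT.
by rewrite (le_trans (ler_normD _ _))// lerD// ?fM ?gN.
Qed.

Lemma causalZ c f : causal f -> causal (fun s => c * f s).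
Proof.
move=> [mf f0 fb]; split; first exact: measurable_funM.
  by move=> s s0; rewrite f0// mulr0.
by move=> T; have [M fM] := fb T; exists (`|c| * M) => s sT; rewrite normrM ler_wpM2l// fM.
Qed.

Lemma conv_le p f g t : 0 < p -> causal f -> causal g ->
  (forall s, 0 <= s < t -> f s <= g s) -> conv p f t <= conv p g t.
Proof.
move=> p0 cf cg fg; have [_ f0 _] := cf; have [_ g0 _] := cg.
apply: le_Rintegral => //; try exact: conv_integrable.
move=> s _; have [s0|s0] := ltP s 0; first by rewrite f0// g0.
have [ts|st] := leP t s; first by rewrite ker_le0 ?mul0r// subr_le0.
by rewrite ler_wpM2l ?ker_ge0// fg// s0.
Qed.

Lemma conv_norm_le p f g t : 0 < p -> causal f -> causal g ->
  (forall s, 0 <= s < t -> `|f s| <= g s) -> `|conv p f t| <= conv p g t.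
Proof.
move=> p0 cf cg fg; rewrite ler_norml; apply/andP; split.
  rewrite -mulN1r -convZ//; apply: conv_le => //; first exact: causalZ.
  by move=> s st; rewrite mulN1r; have := fg _ st; rewrite ler_norml => /andP[].
by apply: conv_le => // s st; exact: le_trans (ler_norm _) (fg _ st).
Qed.

Lemma conv_bound p f t M : 0 < p -> causal f -> 0 <= t ->
  (forall s, 0 <= s < t -> `|f s| <= M) -> `|conv p f t| <= M * (t `^ p / p).
Proof.
move=> p0 cf t0 fM; rewrite -conv_unit// -convZ//; last exact: ext1_causal.
apply: conv_norm_le => //; first exact/causalZ/ext1_causal.
by move=> s st; rewrite ext_ge0 ?mulr1 ?fM//; case/andP: st.
Qed.

Lemma causal_shift e f : 0 <= e -> causal f -> causal (fun s => f (s - e)).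
Proof.
move=> e0 [mf f0 fb]; split.
- by apply: (@measurableT_comp _ _ _ _ _ _ f) => //; exact: measurable_funB.
- by move=> s s0; rewrite f0// (le_lt_trans _ s0)// gerBl.
- by move=> T; have [M fM] := fb T; exists M => s sT; rewrite fM// (le_trans _ sT)// gerBl.
Qed.

Lemma conv_shift p f t e : causal f ->
  conv p (fun s => f (s - e)) t = conv p f (t - e).
Proof.
move=> [mf _ _]; congr fine.
rewrite (integral_translation e); last first.
  apply: measurable_funM; first exact: measurable_ker_shift.
  by apply: (@measurableT_comp _ _ _ _ _ _ f) => //; exact: measurable_funB.
by apply: eq_integral => s _; rewrite addrK opprD addrA addrAC.
Qed.

End kernel.

(** * The semigroup law of fractional integrals *)

Section kernel_semigroup.
Context {R : realType}.
Implicit Types (p q t s u : R) (f g : R -> R).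
Local Notation mu := (@lebesgue_measure R).

(** Euler's Beta integral B(p, q). It stays an extended real until Tonelli's
    theorem has shown that it is finite. *)
Definition ebeta p q : \bar R := (\int[mu]_v (ker p (1 - v) * ker q v)%:E)%E.

Lemma ker_scale p u w : 0 < u -> ker p (u * w) = u `^ (p - 1) * ker p w.
Proof.
move=> u0; rewrite /ker pmulr_rgt0//; case: ifP => w0; last by rewrite mulr0.
by rewrite powRM// ltW.
Qed.

Lemma measurable_ker_ker p q u :
  measurable_fun [set: R] (fun v => ker p (u - v) * ker q v).
Proof.
by apply: measurable_funM; [exact: measurable_ker_shift|exact: measurable_ker].
Qed.

(** The substitution v -> u v makes the dependence on u explicit by
    homogeneity. *)
Lemma integral_ker_ker p q u :
  (\int[mu]_v (ker p (u - v) * ker q v)%:E = (ker (p + q) u)%:E * ebeta p q)%E.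
Proof.
have [u0|u0] := leP u 0.
  rewrite [in RHS]ker_le0// mul0e integral0_eq// => v _.
  have [v0|v0] := leP v 0; first by rewrite (ker_le0 _ v0) mulr0.
  by rewrite ker_le0 ?mul0r// subr_le0 (le_trans u0)// ltW.
rewrite (ge0_integral_affine 0 u0); last 2 first.
- by apply/measurable_EFinP; exact: measurable_ker_ker.
- by move=> v; rewrite lee_fin mulr_ge0// ker_ge0.
rewrite (ker_gt0 _ u0) /ebeta.
transitivity (u%:E * \int[mu]_v ((u `^ (p - 1) * u `^ (q - 1))%:E *
    (ker p (1 - v) * ker q v)%:E))%E.
  congr (_ * _)%E; apply: eq_integral => v _.
  rewrite addr0 -{1}(mulr1 u) -mulrBr !ker_scale//= -EFinM; congr EFin.
  by rewrite mulrACA.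
rewrite ge0_integralZl//; last 3 first.
- by apply/measurable_EFinP; exact: measurable_ker_ker.
- by move=> v _; rewrite lee_fin mulr_ge0// ker_ge0.
- by rewrite lee_fin mulr_ge0// powR_ge0.
rewrite muleA -EFinM; congr (_%:E * _)%E.
have un0 : u != 0 by rewrite gt_eqF.
rewrite -powRD ?un0 ?implybT// -{1}(powRr1 (ltW u0)) -powRD ?un0 ?implybT//.
by congr (_ `^ _); ring.
Qed.

Lemma measurable_econv q f : measurable_fun [set: R] f -> (forall s, 0 <= f s) ->
  measurable_fun [set: R] (fun s => \int[mu]_r (ker q (s - r) * f r)%:E)%E.
Proof.
move=> mf f0.
pose F (z : measurableTypeR R * measurableTypeR R) : \bar R :=
  (ker q (z.1 - z.2) * f z.2)%:E.
have mF : measurable_fun [set: measurableTypeR R * measurableTypeR R] F.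
  have m1 : measurable_fun [set: measurableTypeR R * measurableTypeR R] fst by exact: measurable_fst.
  have m2 : measurable_fun [set: measurableTypeR R * measurableTypeR R] snd by exact: measurable_snd.
  have m3 : measurable_fun [set: measurableTypeR R * measurableTypeR R]
      (fun z => z.1 - z.2 : measurableTypeR R) by exact: measurable_funB.
  apply/measurable_EFinP; apply: measurable_funM.
    exact: (measurableT_comp (measurable_ker q) m3).
  exact: (measurableT_comp mf m2).
have F0 z : (0 <= F z)%E by rewrite lee_fin !mulr_ge0// ker_ge0.
exact: (@measurable_fun_fubini_tonelli_F _ _ _ _ _ mu F mF F0).
Qed.

(** Tonelli's theorem exchanges the two integrations; translating and scaling the
    inner variable leaves the kernel of order p + q times the Beta integral. *)
Lemma econv_conv p q f t : measurable_fun [set: R] f -> (forall s, 0 <= f s) ->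
  (\int[mu]_s ((ker p (t - s))%:E * \int[mu]_r (ker q (s - r) * f r)%:E) =
   ebeta p q * \int[mu]_r (ker (p + q) (t - r) * f r)%:E)%E.
Proof.
move=> mf f0.
pose F (z : measurableTypeR R * measurableTypeR R) : \bar R :=
  (ker p (t - z.1) * (ker q (z.1 - z.2) * f z.2))%:E.
have mF : measurable_fun [set: measurableTypeR R * measurableTypeR R] F.
  have m1 : measurable_fun [set: measurableTypeR R * measurableTypeR R] fst by exact: measurable_fst.
  have m2 : measurable_fun [set: measurableTypeR R * measurableTypeR R] snd by exact: measurable_snd.
  have m3 : measurable_fun [set: measurableTypeR R * measurableTypeR R]
      (fun z => z.1 - z.2 : measurableTypeR R) by exact: measurable_funB.
  apply/measurable_EFinP; apply: measurable_funM.
    exact: (measurableT_comp (measurable_ker_shift p t) m1).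
  apply: measurable_funM; first exact: (measurableT_comp (measurable_ker q) m3).
  exact: (measurableT_comp mf m2).
have F0 z : (0 <= F z)%E by rewrite lee_fin !mulr_ge0// ker_ge0.
have mkf s : measurable_fun [set: R] (fun r => ker q (s - r) * f r).
  by apply: measurable_funM => //; exact: measurable_ker_shift.
have mkf2 s : measurable_fun [set: R] (fun r => ker (p + q) (s - r) * f r).
  by apply: measurable_funM => //; exact: measurable_ker_shift.
transitivity (\int[mu]_s \int[mu]_r F (s, r))%E.
  apply: eq_integral => s _; rewrite -ge0_integralZl//.
  - by apply/measurable_EFinP; exact: mkf.
  - by move=> r _; rewrite lee_fin mulr_ge0// ker_ge0.
  - by rewrite lee_fin ker_ge0.
rewrite (fubini_tonelli F)//.
transitivity (\int[mu]_r (ebeta p q * (ker (p + q) (t - r) * f r)%:E))%E.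
  apply: eq_integral => r _.
  transitivity ((f r)%:E * \int[mu]_s (ker p (t - s) * ker q (s - r))%:E)%E.
    rewrite -ge0_integralZl//.
    - by apply: eq_integral => s _; rewrite /F/= -EFinM; congr EFin; ring.
    - apply/measurable_EFinP; apply: measurable_funM; first exact: measurable_ker_shift.
      by apply: (@measurableT_comp _ _ _ _ _ _ (ker q)); [exact: measurable_ker|exact: measurable_funB].
    - by move=> s _; rewrite lee_fin mulr_ge0// ker_ge0.
    - by rewrite lee_fin.
  rewrite (integral_translation r); last first.
    apply: measurable_funM; first exact: measurable_ker_shift.
    by apply: (@measurableT_comp _ _ _ _ _ _ (ker q)); [exact: measurable_ker|exact: measurable_funB].
  under eq_integral do rewrite addrK opprD addrA addrAC.
  by rewrite integral_ker_ker EFinM muleA [LHS]muleC; congr (_ * _)%E; exact: muleC.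
rewrite ge0_integralZl//.
- by apply/measurable_EFinP; exact: mkf2.
- by move=> r _; rewrite lee_fin mulr_ge0// ker_ge0.
- by apply: integral_ge0 => v _; rewrite lee_fin mulr_ge0// ker_ge0.
Qed.

Lemma ext1_01 s : 0 <= ext (cst (1 : R)) s <= 1.
Proof. by rewrite /ext; case: ifP; rewrite lexx ler01. Qed.

(** Finiteness is read off from the iterated integral of the unit step: the
    inner integral is at most 1 / q on [0, 1], so the double integral is finite,
    while the single integral multiplying B(p, q) is positive. *)
Lemma ebeta_fin_num p q : 0 < p -> 0 < q -> ebeta p q \is a fin_num.
Proof.
move=> p0 q0.
have u0 s : 0 <= ext (cst (1 : R)) s by case/andP: (ext1_01 s).
have mu1 : measurable_fun [set: R] (ext (cst (1 : R))) by have [] := ext1_causal (R := R).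
have := @econv_conv p q (ext (cst 1)) 1 mu1 u0.
rewrite integral_ker_unit ?addr_gt0// powR1 => h.
have b0 : (0 <= ebeta p q)%E.
  by apply: integral_ge0 => v _; rewrite lee_fin mulr_ge0// ker_ge0.
rewrite ge0_fin_numE// ltNge leye_eq; apply/negP => /eqP boo.
move: h; rewrite boo gt0_mulye; last by rewrite lte_fin divr_gt0// addr_gt0.
apply/eqP; rewrite lt_eqF//.
apply: (@le_lt_trans _ _ (\int[mu]_s (q^-1%:E * (ker p (1 - s) * ext (cst 1) s)%:E))%E).
  apply: ge0_le_integral => //.
  - move=> s _; apply: mule_ge0; first by rewrite lee_fin ker_ge0.
    by apply: integral_ge0 => r _; rewrite lee_fin mulr_ge0// ker_ge0.
  - apply: emeasurable_funM; last exact: measurable_econv.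
    by apply/measurable_EFinP; exact: measurable_ker_shift.
  - apply/measurable_EFinP; apply: measurable_funM => //; apply: measurable_funM => //.
    exact: measurable_ker_shift.
  move=> s _.
  have [s0|s0] := ltP s 0.
    rewrite [X in (_ * X)%E]integral0_eq ?mule0 ?lee_fin ?mulr_ge0 ?invr_ge0 ?ker_ge0// ?ltW//.
    move=> r _; have [r0|r0] := ltP r 0; first by rewrite ext_lt0// mulr0.
    by rewrite ker_le0 ?mul0r// subr_le0 ltW// (lt_le_trans s0).
  rewrite integral_ker_unit// ext_ge0// mulr1 -!EFinM lee_fin mulrA.
  rewrite [leRHS]mulrC ler_pM2r ?invr_gt0//.
  have [s1|s1] := leP 1 s; first by rewrite ker_le0 ?mul0r// subr_le0.
  rewrite ler_piMr ?ker_ge0//.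
  have : s `^ q <= 1 `^ q by rewrite ge0_ler_powR// ?nnegrE// ltW.
  by rewrite powR1.
rewrite ge0_integralZl//.
- by rewrite integral_ker_unit// -EFinM ltry.
- by apply/measurable_EFinP; apply: measurable_funM => //; exact: measurable_ker_shift.
- by move=> s _; rewrite lee_fin mulr_ge0// ker_ge0.
- by rewrite lee_fin invr_ge0 ltW.
Qed.

Definition Beta p q : R := fine (ebeta p q).

Lemma ebetaE p q : 0 < p -> 0 < q -> ebeta p q = (Beta p q)%:E.
Proof. by move=> p0 q0; rewrite fineK// ebeta_fin_num. Qed.

Lemma Beta_ge1 p q : 0 < p <= 1 -> 0 < q <= 1 -> 1 <= Beta p q.
Proof.
move=> /andP[p0 p1] /andP[q0 q1]; rewrite -lee_fin -ebetaE//.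
have -> : 1%:E = (\int[mu]_(v in `]0%R, 1%R[) (cst 1 v))%E :> \bar R.
  have m01 := @lebesgue_measure_itv R `]0, 1[%R.
  rewrite integral_cst; last exact: measurable_itv.
  by rewrite mul1e [RHS]m01/= lte_fin ltr01 oppr0 adde0.
rewrite [leLHS]integral_mkcond.
apply: ge0_le_integral => //.
- by move=> v _; rewrite patchE; case: ifP.
- by apply/(measurable_restrictT _ _).1.
- by apply/measurable_EFinP; exact: measurable_ker_ker.
have ker1 (r w : R) : r <= 1 -> 0 < w < 1 -> 1 <= ker r w.
  move=> r1 /andP[w0 w1]; rewrite ker_gt0// -[leLHS](powRr0 w).
  by apply: ger_powR; [rewrite w0 ltW|rewrite subr_le0].
move=> v _; rewrite patchE mem_setE in_itv/=; case: ifP => [/andP[v0 v1]|_]; last first.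
  by rewrite lee_fin mulr_ge0// ker_ge0.
by rewrite lee_fin mulr_ege1// ker1//; lra.
Qed.

Lemma EFin_conv p f t : 0 < p -> causal f ->
  (\int[mu]_s (ker p (t - s) * f s)%:E = (conv p f t)%:E)%E.
Proof.
move=> p0 cf; rewrite /conv /Rintegral fineK//.
by apply: integrable_fin_num => //; exact: conv_integrable.
Qed.

(** Positive part; with the positive part of the opposite function it transfers
    the results of Tonelli's theorem to functions of any sign. *)
Definition fpos f s : R := Num.max (f s) 0.

Lemma fpos_causal f : causal f -> causal (fpos f).
Proof.
move=> [mf f0 fb]; split; first exact: measurable_maxr.
  by move=> s s0; rewrite /fpos f0// maxxx.
move=> T; have [M fM] := fb T; exists M => s sT.
apply: le_trans (fM _ sT).
by rewrite ler_norml ge_max ler_norm normr_ge0 le_max oppr_le0 normr_ge0 orbT.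
Qed.

Lemma fpos_ge0 f s : 0 <= fpos f s.
Proof. by rewrite /fpos le_max lexx orbT. Qed.

Lemma fpos_sub f : f = (fun s => fpos f s + - 1 * fpos (fun s => - 1 * f s) s).
Proof.
apply/funext => s; rewrite /fpos !mulN1r.
by case: (leP 0 (f s)) => fs; case: (leP 0 (- f s)) => fs'; lra.
Qed.

Lemma conv_pos_causal q f : 0 < q -> causal f -> (forall s, 0 <= f s) ->
  causal (conv q f).
Proof.
move=> q0 cf f0; split.
- have -> : conv q f = fine \o (fun s => \int[mu]_r (ker q (s - r) * f r)%:E)%E by [].
  apply: measurableT_comp; first exact: fine_measurable.
  by apply: measurable_econv => //; have [] := cf.
- by move=> s s0; rewrite conv_le0// ltW.
move=> T; have [M M0 fM] := causal_bound T cf.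
exists (M * (Num.max 0 T `^ q / q)) => s sT.
have T0 : 0 <= Num.max 0 T by rewrite le_max lexx.
have [s0|s0] := leP s 0.
  by rewrite conv_le0// normr0 mulr_ge0// divr_ge0 ?powR_ge0// ltW.
apply: le_trans (conv_bound q0 cf (ltW s0) _) _.
  by move=> r /andP[r0 rs]; apply: fM; rewrite (le_trans (ltW rs)).
rewrite ler_wpM2l// ler_pM2r ?invr_gt0//.
by rewrite ge0_ler_powR// ?nnegrE ?le_max ?sT ?orbT// ltW.
Qed.

Lemma conv_fpos_sub q f : 0 < q -> causal f ->
  conv q f = (fun t => conv q (fpos f) t + - 1 * conv q (fpos (fun s => - 1 * f s)) t).
Proof.
move=> q0 cf; apply/funext => t; rewrite [in LHS](fpos_sub f) convD//.
- by rewrite convZ//; exact/fpos_causal/causalZ.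
- exact: fpos_causal.
- exact/causalZ/fpos_causal/causalZ.
Qed.

Lemma conv_causal q f : 0 < q -> causal f -> causal (conv q f).
Proof.
move=> q0 cf; rewrite conv_fpos_sub//.
have c1 := fpos_causal cf; have c2 := fpos_causal (causalZ (-1) cf).
by apply: causalD; [|apply: causalZ]; apply: conv_pos_causal => // s; exact: fpos_ge0.
Qed.

Lemma conv_conv p q f t : 0 < p -> 0 < q -> causal f ->
  conv p (conv q f) t = Beta p q * conv (p + q) f t.
Proof.
move=> p0 q0; have pq0 : 0 < p + q by rewrite addr_gt0.
have H g : causal g -> (forall s, 0 <= g s) ->
    conv p (conv q g) t = Beta p q * conv (p + q) g t.
  move=> cg g0; have [mg _ _] := cg.
  apply: EFin_inj; rewrite -EFin_conv//; last exact: conv_causal.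
  rewrite EFinM -(ebetaE p0 q0) -(EFin_conv _ pq0 cg).
  refine (etrans _ (econv_conv p q t mg g0)).
  by apply: eq_integral => s _; rewrite EFin_conv.
move=> cf; have c1 := fpos_causal cf; have c2 := fpos_causal (causalZ (-1) cf).
have p1 s := fpos_ge0 f s; have p2 s := fpos_ge0 (fun s => -1 * f s) s.
rewrite (conv_fpos_sub q0 cf) (conv_fpos_sub pq0 cf) convD//; last 2 first.
- exact: conv_causal.
- by apply: causalZ; exact: conv_causal.
by rewrite convZ//; [rewrite !H//; ring|exact: conv_causal].
Qed.

End kernel_semigroup.

(** * Positivity of the Gamma function on ]0, 1[ *)

Section gamma.
Context {R : realType}.
Implicit Types (p q t s u z : R) (f g : R -> R).
Local Notation mu := (@lebesgue_measure R).

Lemma Gamma_ge0 z : 0 <= Gamma z.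
Proof.
by apply: Rintegral_ge0 => t _; rewrite mulr_ge0// ?powR_ge0// expR_ge0.
Qed.

Lemma integral_powR01 z : 0 < z ->
  (\int[mu]_(t in `]0%R, 1%R[) (t `^ (z - 1))%:E = (z^-1)%:E)%E.
Proof.
move=> z0; pose F t := z^-1 *: (t `^ z).
transitivity (F 1 - F 0)%:E; last first.
  by rewrite /F powR1 powR0 ?gt_eqF// scaler0 subr0; congr EFin; rewrite -[LHS]/(_ * _) mulr1.
have dF (x : R) : 0 < x -> is_derive x 1 F (x `^ (z - 1)).
  move=> x0; have h := is_derive1_powR z x0; apply: is_derive_eq.
  by rewrite -[LHS]/(_ * _) mulrA mulVf ?mul1r// gt_eqF.
apply: ge0_FTC_oo => //.
- by move=> x _; exact: powR_ge0.
- move=> x /andP[x0 _]; apply: differentiable_continuous; apply/derivable1_diffP.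
  by have [] := is_derive1_powR (z - 1) x0.
- by move=> x /andP[x0 _]; exact: dF.
- by rewrite {2}/F powR0 ?gt_eqF//; apply: cvgZr; exact: powR_cvg0.
- apply: cvg_at_left_filter; apply: differentiable_continuous; apply/derivable1_diffP.
  by have [] := dF 1 ltr01.
Qed.

Lemma integral_expN : (\int[mu]_(t in `[0%R, +oo[) (expR (- t))%:E = 1%:E)%E.
Proof.
pose F t := - expR (- t).
have dF (x : R) : is_derive x 1 F (expR (- x)).
  apply: is_derive_eq.
  by rewrite -[X in - X]/(_ * _) mulrN1 opprK.
have cF : continuous F.
  move=> x; apply: differentiable_continuous; apply/derivable1_diffP.
  by have [] := dF x.
rewrite (@ge0_continuous_FTC2y _ _ F 0 0).
- by rewrite /F oppr0 expR0 -EFinB sub0r opprK.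
- by move=> x _; exact: expR_ge0.
- apply: continuous_subspaceT => x; apply: differentiable_continuous.
  exact/derivable1_diffP.
- rewrite -oppr0; apply: cvgN.
  exact: cvgr_expR.
- by move=> x _; have [] := dF x.
- exact/cvg_at_right_filter/cF.
- by move=> x _; rewrite derive1E; have [] := dF x.
Qed.

(** The integral must be shown finite before it is bounded below, because the
    real-valued integral of a function with infinite integral is 0. The two
    majorants are t^(z-1) on ]0, 1[ and exp(-t) elsewhere; the minorant is a
    constant on [1, 2]. *)
Lemma Gamma_gt0 z : 0 < z < 1 -> 0 < Gamma z.
Proof.
move=> /andP[z0 z1].
pose G t := t `^ (z - 1) * expR (- t).
have G0 t : 0 <= G t by rewrite mulr_ge0// ?powR_ge0// expR_ge0.
have mE : measurable_fun [set: R] (fun t => expR (- t)).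
  by apply: continuous_measurable_fun => x; apply: differentiable_continuous; exact/derivable1_diffP.
have mP : measurable_fun [set: R] (fun t => t `^ (z - 1)) by exact: measurable_powR.
have mG : measurable_fun [set: R] G by exact: measurable_funM.
have mGD (D : set R) : measurable_fun D (EFin \o G).
  by apply/measurable_EFinP; exact: measurable_funTS.
have Gfin : (\int[mu]_(t in `[0%R, +oo[) (G t)%:E < +oo)%E.
  apply: (@le_lt_trans _ _ (\int[mu]_(t in `[0%R, +oo[)
     ((((fun t => t `^ (z - 1)) \_ `]0, 1[) t)%:E + (expR (- t))%:E))%E).
    apply: ge0_le_integral => //.
    - by move=> t _; rewrite lee_fin.
    - exact: mGD.
    - apply: emeasurable_funD; apply/measurable_EFinP; apply: measurable_funTS => //.
      exact/(measurable_restrictT _ _).1/measurable_funTS.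
    - move=> t; rewrite /= in_itv/= andbT => t0.
      rewrite -EFinD lee_fin patchE mem_setE in_itv/=.
      have [t1|t1] := leP 1 t.
        rewrite andbF add0r /G ler_piMl ?expR_ge0// -[leRHS](powRr0 t).
        by apply: ler_powR => //; rewrite subr_le0 ltW.
      move: t0; rewrite le_eqVlt => /predU1P[<-|t0].
        by rewrite ltxx /= /G powR0 ?mul0r ?add0r ?expR_ge0// subr_eq0 lt_eqF.
      rewrite t0 /= /G ler_wpDr ?expR_ge0// ler_piMr ?powR_ge0//.
      by rewrite -expR0 ler_expR oppr_le0 ltW.
  rewrite ge0_integralD//.
  - rewrite integral_expN.
    under eq_integral => t _.
      rewrite (_ : _%:E = ((fun t => (t `^ (z - 1))%:E) \_ `]0, 1[) t).
        over.
      by rewrite !patchE; case: ifP.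
    rewrite -integral_mkcondr.
    rewrite (_ : `[0, +oo[ `&` `]0, 1[ = `]0, 1[)%classic.
      by rewrite integral_powR01// -EFinD ltry.
    apply/seteqP; split => x /=; rewrite !in_itv/= ?andbT; first by case.
    by move=> x01; split => //; case/andP: x01 => /ltW.
  - by move=> t _; rewrite lee_fin patchE; case: ifP => // _; exact: powR_ge0.
  - by apply/measurable_EFinP; apply: measurable_funTS; exact/(measurable_restrictT _ _).1/measurable_funTS.
  - by apply/measurable_EFinP; apply: measurable_funTS.
rewrite /Gamma /Rintegral fine_gt0// Gfin andbT.
pose c := 2 `^ (z - 1) * expR (- 2).
have c0 : 0 < c by rewrite mulr_gt0 ?powR_gt0 ?expR_gt0.
apply: (@lt_le_trans _ _ (\int[mu]_(t in `[1%R, 2%R]) (cst c%:E t))%E).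
  have m12 := @lebesgue_measure_itv R `[1, 2]%R.
  rewrite integral_cst; last exact: measurable_itv.
  rewrite [X in (_ * X)%E]m12/= lte_fin ltr1n -EFinD -EFinM lte_fin mulr_gt0//; lra.
apply: (@le_trans _ _ (\int[mu]_(t in `[1%R, 2%R]) (G t)%:E)%E).
  apply: ge0_le_integral => //.
  - by move=> t _; rewrite lee_fin ltW.
  - exact: mGD.
  - move=> t /=; rewrite in_itv/= => /andP[t1 t2]; rewrite lee_fin /c /G.
    apply: ler_pM; rewrite ?powR_ge0 ?expR_ge0//; last by rewrite ler_expR lerN2.
    rewrite -[z - 1]opprB !powRN lef_pV2 ?posrE ?powR_gt0 ?(lt_le_trans _ t1)//.
    by rewrite ge0_ler_powR// ?nnegrE ?subr_ge0 ?(le_trans _ t1)// ltW.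
apply: ge0_subset_integral => //.
- exact: mGD.
- by move=> x _; rewrite lee_fin.
- by move=> x /=; rewrite !in_itv/= andbT => /andP[x1 _]; rewrite (le_trans _ x1).
Qed.

End gamma.

(** * The fractional integral of order one *)

Section derivative_conv1.
Context {R : realType}.
Implicit Types (p q t s u z : R) (f g : R -> R).
Local Notation mu := (@lebesgue_measure R).

Lemma causal_integrable f t : causal f ->
  mu.-integrable `]-oo, t] (EFin \o f).
Proof.
move=> cf; have : mu.-integrable `]-oo, t] (fun s => (ker 1 (t + 1 - s) * f s)%:E).
  by apply: integrableS (conv_integrable (t + 1) ltr01 cf).
apply: eq_integrable => // s; rewrite inE/= in_itv/= => st.
by rewrite ker_gt0 ?subrr ?powRr0 ?mul1r// subr_gt0 (le_lt_trans st)// ltrDl.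
Qed.

Lemma conv1E f t : causal f -> conv 1 f t = \int[mu]_(s in `]-oo, t]) f s.
Proof.
move=> cf; rewrite -Rintegral_itv_bndo_bndc; last first.
  apply: integrableS (causal_integrable t cf) => //.
  by move=> s /=; rewrite !in_itv/=; exact: ltW.
rewrite Rintegral_mkcond; apply: eq_Rintegral => s _.
rewrite patchE mem_setE in_itv/=; case: ltP => st.
  by rewrite ker_gt0 ?subr_gt0// subrr powRr0 mul1r.
by rewrite ker_le0 ?mul0r// subr_le0.
Qed.

Lemma is_derive_conv1 f t : causal f -> {for t, continuous f} ->
  is_derive (t : R) 1 (conv 1 f) (f t).
Proof.
move=> cf ct.
have -> : conv 1 f = fun t => \int[mu]_(s in `]-oo, t]) f s.
  by apply/funext => s; exact: conv1E.
have tt1 : t < t + 1 by rewrite ltrDl.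
have [|//|h1 h2] := @continuous_FTC1 R f -oo%O t (t + 1) tt1 (causal_integrable (t + 1) cf).
  by rewrite /= ltNyr.
by apply: DeriveDef; [exact: h1|rewrite -derive1E; exact: h2].
Qed.

End derivative_conv1.

(** * Two kernel estimates *)

(** Comparison of integrands rather than of functions: the two majorants may
    carry kernels of different orders, as in a splitting of the integral into the
    parts far from and close to the singularity. *)
Lemma conv_le_split (R : realType) (p q t : R) (f g k : R -> R) :
  0 < p -> 0 < q -> causal f -> causal g -> causal k ->
  (forall s, 0 <= s < t ->
    ker p (t - s) * f s <= ker q (t - s) * g s + ker p (t - s) * k s) ->
  conv p f t <= conv q g t + conv p k t.
Proof.
move=> p0 q0 cf cg ck H.
have ip := conv_integrable t p0 cf.
have iq := conv_integrable t q0 cg.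
have ik := conv_integrable t p0 ck.
rewrite /conv -RintegralD//; apply: le_Rintegral => //; first exact: (integrableD measurableT iq ik).
have [_ f0 _] := cf; have [_ g0 _] := cg; have [_ k0 _] := ck.
move=> s _; have [s0|s0] := ltP s 0; first by rewrite f0// g0// k0// !mulr0 addr0.
have [ts|st] := leP t s; first by rewrite !ker_le0 ?subr_le0// !mul0r addr0.
by apply: H; rewrite s0.
Qed.

Lemma powR_le_neg (R : realType) (x y r : R) : 0 < x -> x <= y -> r <= 0 ->
  y `^ r <= x `^ r.
Proof.
move=> x0 xy r0; have y0 := lt_le_trans x0 xy.
rewrite -[r]opprK !(powRN _ (- r)) lef_pV2 ?posrE ?powR_gt0//.
by rewrite ge0_ler_powR// ?nnegrE ?oppr_ge0// ltW.
Qed.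

(** The kernel of order 1 + q is nondecreasing, so moving the evaluation time
    forward does not decrease the contribution of the part of f after T, where f
    is nonnegative. The part before T is bounded by M, and the kernel increment
    there is at most t2 - t1, since u^q has slope at most 1 for u >= 1. *)
Lemma conv_nonneg_tail (R : realType) (q T t1 t2 M : R) (f : R -> R) :
  0 < q <= 1 -> causal f -> 0 <= T -> (forall s, T <= s -> 0 <= f s) ->
  0 <= M -> (forall s, s <= T -> `|f s| <= M) ->
  T + 1 <= t1 -> t1 <= t2 ->
  conv (1 + q) f t1 <= conv (1 + q) f t2 + M * (t2 - t1) * (T + 1).
Proof.
move=> /andP[q0 q1] cf T0 fT M0 fM Tt1 t12.
pose k := M * (t2 - t1).
have k0 : 0 <= k by rewrite mulr_ge0// subr_ge0.
have p0 : 0 < 1 + q by rewrite addr_gt0.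
have T10 : 0 <= T + 1 by rewrite addr_ge0.
have c1 := causalZ k (ext1_causal (R := R)).
have -> : M * (t2 - t1) * (T + 1) = conv 1 (fun s => k * ext (cst 1) s) (T + 1).
  by rewrite convZ ?conv_unit ?powRr1 ?divr1//; exact: ext1_causal.
have i1 := conv_integrable t1 p0 cf.
have i2 := conv_integrable t2 p0 cf.
have i3 := conv_integrable (T + 1) ltr01 c1.
have kerE u : 0 <= u -> ker (1 + q) u = u `^ q.
  rewrite le_eqVlt => /predU1P[<-|u0]; first by rewrite ker_le0// powR0 ?gt_eqF.
  by rewrite ker_gt0//; congr (_ `^ _); ring.
have kermono u v : u <= v -> ker (1 + q) u <= ker (1 + q) v.
  move=> uv; have [u0|u0] := leP u 0; first by rewrite (ker_le0 _ u0) ker_ge0.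
  have v0 := lt_le_trans u0 uv.
  rewrite (kerE _ (ltW u0)) (kerE _ (ltW v0)).
  by rewrite ge0_ler_powR ?nnegrE ?(ltW q0) ?(ltW u0) ?(ltW v0).
have kerlip u v : 1 <= u -> u <= v -> ker (1 + q) v - ker (1 + q) u <= v - u.
  move=> u1 uv; have u0 := lt_le_trans ltr01 u1; have v0 := lt_le_trans u0 uv.
  rewrite (kerE _ (ltW u0)) (kerE _ (ltW v0)) -(mulr_powRB1 (ltW u0) q0) -(mulr_powRB1 (ltW v0) q0).
  apply: (@le_trans _ _ ((v - u) * u `^ (q - 1))).
    by rewrite mulrBl lerD2r ler_wpM2l ?(ltW v0)// powR_le_neg// subr_le0.
  by rewrite ler_piMr ?subr_ge0// -[leRHS](powRr0 u) ler_powR// subr_le0.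
rewrite /conv -[leRHS](RintegralD measurableT i2 i3).
apply: le_Rintegral => //; first exact: (integrableD measurableT i2 i3).
move=> s _; have [_ f0 _] := cf.
have [s0|s0] := ltP s 0; first by rewrite f0// ext_lt0// !mulr0 addr0.
rewrite ext_ge0// mulr1.
have d0 : 0 <= ker (1 + q) (t2 - s) - ker (1 + q) (t1 - s).
  by rewrite subr_ge0 kermono// lerD2r.
rewrite -lerBlDl -mulrBl.
have [sT|Ts] := leP s T; last first.
  apply: (@le_trans _ _ 0); last by rewrite mulr_ge0 ?ker_ge0.
  by rewrite mulr_le0_ge0 ?fT ?(ltW Ts)// -opprB oppr_le0.
have Ts1 : 0 < T + 1 - s by rewrite subr_gt0 (le_lt_trans sT)// ltrDl.
rewrite (ker_gt0 _ Ts1) subrr powRr0 mul1r /k.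
apply: le_trans (ler_norm _) _; rewrite normrM distrC (ger0_norm d0) mulrC.
apply: ler_pM; rewrite ?fM//.
rewrite (_ : t2 - t1 = (t2 - s) - (t1 - s)); last by ring.
apply: kerlip; last by rewrite lerD2r.
by rewrite lerBrDr (le_trans _ Tt1)// addrC lerD2r.
Qed.

(** * Riemann-Liouville integrals and the comparison principle *)

(** For causal f this is the Riemann-Liouville integral of order p. Setting it to
    the identity at p = 0 treats Caputo derivatives of order 1 uniformly. *)
Definition rl (R : realType) (p : R) (f : R -> R) (t : R) : R :=
  if p == 0 then f t else (Gamma p)^-1 * conv p f t.

Lemma frac_int_rl (R : realType) (p : R) (f : R -> R) (t : R) :
  p != 1 -> 0 <= t -> frac_int p f t = rl p (ext f) t.
Proof.
move=> p1 t0; rewrite /frac_int /rl; case: eqVneq => [_|pn0].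
  by rewrite ext_ge0.
congr (_ * _); rewrite Rintegral_mkcond; apply: eq_Rintegral => s _.
rewrite patchE mem_setE in_itv/= /ext /ker.
case: (leP 0 s) => s0 /=; last by rewrite mulr0.
have [st|ts] := leP s t; last by rewrite ltNge subr_le0 (ltW ts) mul0r.
move: st; rewrite le_eqVlt => /predU1P[->|st]; last by rewrite subr_gt0 st.
by rewrite subrr ltxx powR0// subr_eq0.
Qed.

(* Keeps unification from unfolding integrals. *)
Opaque conv Gamma Beta ker.

Section riemann_liouville.
Context {R : realType}.
Implicit Types (p q t s u z a b : R) (f g w W : R -> R).
Local Notation mu := (@lebesgue_measure R).

Lemma rlD p f g t : 0 <= p -> causal f -> causal g ->
  rl p (fun s => f s + g s) t = rl p f t + rl p g t.
Proof.
move=> p0 cf cg; rewrite /rl; case: eqVneq => // pn0.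
by rewrite convD ?mulrDr// lt_def pn0.
Qed.

Lemma rlZ p f k t : 0 <= p -> causal f ->
  rl p (fun s => k * f s) t = k * rl p f t.
Proof.
move=> p0 cf; rewrite /rl; case: eqVneq => // pn0.
by rewrite convZ//; [exact: mulrCA|rewrite lt_def pn0].
Qed.

Lemma rl_shift p f t e : causal f -> rl p (fun s => f (s - e)) t = rl p f (t - e).
Proof. by move=> cf; rewrite /rl; case: ifP => // _; rewrite conv_shift. Qed.

Lemma rl_norm_le p f g t : 0 <= p -> 0 <= t -> causal f -> causal g ->
  (forall s, 0 <= s <= t -> `|f s| <= g s) -> `|rl p f t| <= rl p g t.
Proof.
move=> p0 t0 cf cg fg; rewrite /rl; case: eqVneq => [_|pn0].
  by apply: fg; rewrite t0 lexx.
rewrite normrM ger0_norm ?invr_ge0 ?Gamma_ge0// ler_wpM2l ?invr_ge0 ?Gamma_ge0//.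
apply: conv_norm_le => //; first by rewrite lt_def pn0.
by move=> s /andP[s0 st]; rewrite fg// s0 ltW.
Qed.

(** The complementary integral turns the primitive defining the Caputo derivative
    of order alpha into an ordinary primitive. The constant is the value
    Gamma(alpha), of which only the sign matters. *)
Lemma conv_rl_compl alpha : 0 < alpha <= 1 -> exists2 C, 0 < C &
  forall f t, causal f -> conv alpha (rl (1 - alpha) f) t = C * conv 1 f t.
Proof.
move=> /andP[a0]; rewrite le_eqVlt => /predU1P[->|a1].
  by exists 1 => // f t cf; rewrite mul1r subrr; congr conv; apply/funext => s; rewrite /rl eqxx.
have p0 : 0 < 1 - alpha by rewrite subr_gt0.
exists ((Gamma (1 - alpha))^-1 * Beta alpha (1 - alpha)).
  rewrite mulr_gt0 ?invr_gt0 ?Gamma_gt0//; first by lra.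
  by rewrite (lt_le_trans ltr01)// Beta_ge1//; lra.
move=> f t cf; rewrite (_ : rl _ f = fun s => (Gamma (1 - alpha))^-1 * conv (1 - alpha) f s).
  rewrite convZ//; last exact: conv_causal.
  by rewrite conv_conv// mulrA (_ : alpha + (1 - alpha) = 1)//; ring.
by apply/funext => s; rewrite /rl gt_eqF.
Qed.

Lemma conv_rl alpha p : 0 < alpha <= 1 -> 0 < p < 1 -> exists2 C, 0 <= C &
  forall f t, causal f -> conv alpha (rl p f) t = C * conv (alpha + p) f t.
Proof.
move=> /andP[a0 a1] /andP[p0 p1].
exists ((Gamma p)^-1 * Beta alpha p).
  rewrite mulr_ge0 ?invr_ge0 ?Gamma_ge0//.
  by rewrite (le_trans ler01)// Beta_ge1 ?a0 ?p0//= ltW.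
move=> f t cf; rewrite (_ : rl _ f = fun s => (Gamma p)^-1 * conv p f s).
  by rewrite convZ ?conv_conv ?mulrA//; exact: conv_causal.
by apply/funext => s; rewrite /rl gt_eqF.
Qed.

(** Right continuity at 0 is part of the notion so that a primitive can be
    compared with its value at 0, although it is differentiated only on t > 0. *)
Definition primitive W w : Prop :=
  (forall s, 0 < s -> is_derive (s : R) 1 W (w s)) /\ W x @[x --> 0^'+] --> W 0.

Lemma is_derive_cont W (d : R) s : is_derive (s : R) 1 W d -> {for s, continuous W}.
Proof.
by move=> [dW _]; apply: differentiable_continuous; apply/derivable1_diffP.
Qed.

Lemma primitive_right W w s : primitive W w -> 0 <= s -> W x @[x --> s^'+] --> W s.
Proof.
move=> [dW W0]; rewrite le_eqVlt => /predU1P[<-//|s0].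
exact/cvg_at_right_filter/is_derive_cont/dW.
Qed.

Lemma primitive_within W w s t : primitive W w -> 0 <= s -> s < t ->
  {within `[s, t], continuous W}.
Proof.
move=> WP s0 st; have [dW _] := WP; apply/continuous_within_itvP => //; split.
- move=> x; rewrite in_itv/= => /andP[sx xt].
  exact: is_derive_cont (dW x (le_lt_trans s0 sx)).
- exact: primitive_right WP s0.
- exact/cvg_at_left_filter/is_derive_cont/dW/(le_lt_trans s0).
Qed.

Lemma primitive_MVT W w s t : primitive W w -> 0 <= s -> s < t ->
  exists2 c, s < c < t & W t - W s = w c * (t - s).
Proof.
move=> WP s0 st; have [dW _] := WP.
have [||c] := @MVT R W w s t st; last by rewrite in_itv/=; exists c.
- by move=> x; rewrite in_itv/= => /andP[sx _]; exact: dW (le_lt_trans s0 sx).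
- exact: primitive_within WP s0 st.
Qed.

Lemma within0y_cont f t : {within `[0, +oo[, continuous f} -> 0 < t -> {for t, continuous f}.
Proof.
move=> /continuous_within_itvcyP[cf _] t0; apply: cf.
by rewrite in_itv/= t0.
Qed.

Lemma within0y_seg f s t : {within `[0, +oo[, continuous f} -> 0 <= s ->
  {within `[s, t], continuous f}.
Proof.
move=> cf s0; apply: continuous_subspaceW cf => x /=; rewrite !in_itv/= andbT.
by case/andP => sx _; exact: le_trans sx.
Qed.

(** The fractional counterpart of Fermat's rule: the convolution is, up to a
    factor, the Riemann-Liouville integral of the derivative of W, hence a Caputo
    derivative of W. Integrating by parts on [0, t - d] against W - W(t), which is
    nonnegative, both the boundary term at 0 and the remaining integral have the
    favourable sign; the boundary term at t - d and the integral over the window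
    of length d are O(d^p), because w is bounded. *)
Lemma conv_nonpos_at_min p W w t : 0 < p < 1 -> 0 < t -> causal w ->
  {within `[0, +oo[, continuous w} -> primitive W w ->
  (forall s, 0 <= s <= t -> W t <= W s) -> conv p w t <= 0.
Proof.
move=> /andP[p0 p1] t0 cw ww WP Wmin.
have [M M0 wM] := causal_bound t cw.
suff bnd d : 0 < d -> d < t -> conv p w t <= (M + M / p) * d `^ p.
  have : (M + M / p) * d `^ p @[d --> 0^'+] --> (M + M / p) * 0.
    by apply: cvgMr; exact: powR_cvg0.
  rewrite mulr0 => lim0.
  apply: (ler_cvg_to (cvg_cst (conv p w t)) lim0).
  near=> d; apply: bnd => //; near: d; exact: nbhs_right_lt.
move=> d0 dt.
pose b := t - d.
have b0 : 0 < b by rewrite subr_gt0.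
have bt : b < t by rewrite ltrBlDr ltrDl.
have tb : t - b = d by rewrite /b opprB addrCA subrr addr0.
pose w1 s := if s <= b then w s else 0.
pose w2 s := if b < s then w s else 0.
have [mw wneg _] := cw.
have cw1 : causal w1.
  split; first by apply: measurable_fun_ifT => //; exact: measurable_fun_ler.
    by move=> s s0; rewrite /w1 wneg//; case: ifP.
  move=> T; have [N N0 wN] := causal_bound T cw; exists N => s sT.
  by rewrite /w1; case: ifP => _; [exact: wN|rewrite normr0].
have cw2 : causal w2.
  split; first by apply: measurable_fun_ifT => //; exact: measurable_fun_ltr.
    by move=> s s0; rewrite /w2 wneg//; case: ifP.
  move=> T; have [N N0 wN] := causal_bound T cw; exists N => s sT.
  by rewrite /w2; case: ifP => _; [exact: wN|rewrite normr0].
have wE : conv p w t = conv p w1 t + conv p w2 t.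
  rewrite -convD//; congr (conv p _ t); apply/funext => s.
  by rewrite /w1 /w2; case: leP => sb; rewrite ?addr0 ?add0r.
have w2le : conv p w2 t <= M / p * d `^ p.
  apply: le_trans (ler_norm _) _.
  have cb := causal_shift (ltW b0) (ext1_causal (R := R)).
  have -> : M / p * d `^ p = conv p (fun s => M * ext (cst 1) (s - b)) t.
    rewrite convZ// conv_shift; last exact: ext1_causal.
    by rewrite conv_unit ?tb ?(ltW d0)//; ring.
  apply: conv_norm_le => //; first exact: causalZ.
  move=> s /andP[s0 st]; rewrite /w2; case: ifP => [bs|_].
    by rewrite ext_ge0 ?mulr1 ?wM ?subr_ge0// ltW.
  by rewrite normr0 mulr_ge0//; case/andP: (ext1_01 (R := R) (s - b)).
have w1le : conv p w1 t <= M * d `^ p.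
  have -> : conv p w1 t = \int[mu]_(s in `[0, b]) ((t - s) `^ (p - 1) * w s).
    rewrite [RHS]Rintegral_mkcond; apply: eq_Rintegral => s _.
    rewrite patchE mem_setE in_itv/= /w1.
    have [s0|s0] := ltP s 0; first by rewrite wneg//=; case: ifP; rewrite mulr0.
    case: leP => sb /=; last by rewrite mulr0.
    by rewrite ker_gt0// subr_gt0 (le_lt_trans sb).
  pose G s := W s - W t.
  have st s : s <= b -> s < t by move=> sb; exact: le_lt_trans sb bt.
  pose F s := (t - s) `^ (p - 1).
  have dK s : s < t -> is_derive (s : R) 1 F
      ((1 - p) * (t - s) `^ (p - 1 - 1)).
    move=> /(is_derive_powR_sub (p - 1)) h; apply: is_derive_eq.
    by rewrite -mulNr opprB.
  have dG s : 0 < s -> is_derive (s : R) 1 G (w s).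
    move=> s0; have h := WP.1 s s0; apply: is_derive_eq; by rewrite subr0.
  rewrite -[leLHS]/(\int[mu]_(s in `[0, b]) (F s * w s)).
  rewrite (@Rintegration_by_parts R F G
     (fun s => (1 - p) * (t - s) `^ (p - 1 - 1)) w)//; last 6 first.
  - apply: continuous_in_subspaceT => s; rewrite inE/= in_itv/= => /andP[_ sb].
    by apply: cvgMr; exact: continuous_powR_sub (st _ sb).
  - split.
    + by move=> s; rewrite in_itv/= => /andP[_ /ltW/st/dK[]].
    + exact/cvg_at_right_filter/is_derive_cont/dK.
    + exact/cvg_at_left_filter/is_derive_cont/dK.
  - by move=> s; rewrite in_itv/= => /andP[_ /ltW/st/dK[]]; rewrite derive1E.
  - exact: within0y_seg.
  - split.
    + by move=> s; rewrite in_itv/= => /andP[/dG[]].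
    + by apply: cvgB; [exact: primitive_right WP _|exact: cvg_cst].
    + exact/cvg_at_left_filter/is_derive_cont/dG.
  - by move=> s; rewrite in_itv/= => /andP[/dG[]]; rewrite derive1E.
  have G0 s : 0 <= s <= t -> 0 <= G s by move=> h; rewrite subr_ge0 Wmin.
  have i0 : 0 <= \int[mu]_(s in `[0, b]) ((1 - p) * (t - s) `^ (p - 1 - 1) * G s).
    apply: Rintegral_ge0 => s /=; rewrite in_itv/= => /andP[s0 sb].
    rewrite mulr_ge0//; last by rewrite G0// s0 ltW// st.
    by rewrite mulr_ge0 ?powR_ge0// subr_ge0 ltW.
  have i1 : 0 <= (t - 0) `^ (p - 1) * G 0.
    by rewrite mulr_ge0 ?powR_ge0// G0// lexx ltW.
  have GM : G b <= M * d.
    have [c /andP[bc ct] Wc] := primitive_MVT WP (ltW b0) bt.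
    rewrite /G -opprB Wc tb -mulNr ler_pM2r//.
    by apply: le_trans (ler_norm _) _; rewrite normrN wM// ltW.
  rewrite {1}/F tb.
  have : d `^ (p - 1) * G b <= d `^ (p - 1) * (M * d) by rewrite ler_wpM2l ?powR_ge0.
  rewrite mulrCA [d `^ (p - 1) * d]mulrC mulr_powRB1// ?(ltW d0)//.
  move=> h1; rewrite (_ : F 0 = (t - 0) `^ (p - 1))//.
  have key (x y z v : R) : 0 <= y -> 0 <= z -> x <= v -> x - y - z <= v by lra.
  exact: key.
by rewrite wE mulrDl lerD.
Unshelve. all: by end_near. Qed.

(** For p = 0 the claim is w t <= 0: if w were positive at t it would be positive
    near t, and W would be smaller just before t than at t. *)
Lemma rl_nonpos_at_min p W w t : 0 <= p < 1 -> 0 < t -> causal w ->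
  {within `[0, +oo[, continuous w} -> primitive W w ->
  (forall s, 0 <= s <= t -> W t <= W s) -> rl p w t <= 0.
Proof.
move=> /andP[p0 p1] t0 cw ww WP Wmin; rewrite /rl.
case: eqVneq => [_|pn0]; last first.
  rewrite mulr_ge0_le0 ?invr_ge0 ?Gamma_ge0//.
  by apply: conv_nonpos_at_min WP Wmin => //; rewrite p1 lt_def pn0 p0.
rewrite leNgt; apply/negP => wt0.
have ct : {for t, continuous w} by exact: within0y_cont.
have wnear : \forall s \near t, 0 < w s by exact: (cvgr_gt (w t) ct).
have [e /= e0 be] := wnear.
pose d := Num.min (e / 2) (t / 2).
have d0 : 0 < d by rewrite lt_min !divr_gt0.
have de : d <= e / 2 by rewrite ge_min lexx.
have dt : d <= t / 2 by rewrite ge_min lexx orbT.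
have [||c /andP[c1 c2] Wc] := @primitive_MVT W w (t - d) t WP; [lra|lra|].
have : 0 < w c.
  by apply: be; rewrite /ball_/= gtr0_norm ?subr_gt0//; lra.
have : W t <= W (t - d) by apply: Wmin; apply/andP; split; lra.
rewrite -subr_le0 Wc pmulr_lle0; last by rewrite opprB addrC subrK.
by move=> wc; rewrite ltNge wc.
Qed.

(** At a point where W attains a negative minimum over [0, t], both fractional
    terms are nonpositive and b W is negative, contradicting the assumed
    inequality. *)
Lemma comparison p q a b W w : 0 <= p < 1 -> 0 <= q < 1 -> 0 <= a -> 0 < b ->
  causal w -> {within `[0, +oo[, continuous w} -> primitive W w ->
  0 <= W 0 -> (forall t, 0 < t -> 0 <= rl p w t + a * rl q w t + b * W t) ->
  forall t, 0 <= t -> 0 <= W t.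
Proof.
move=> p01 q01 a0 b0 cw ww WP W0 H t; rewrite le_eqVlt => /predU1P[<-//|t0].
have [c + cmin] := EVT_min (ltW t0) (primitive_within WP (lexx 0) t0).
rewrite in_itv/= => /andP[c0 ct].
have tmin : W c <= W t by apply: cmin; rewrite in_itv/= lexx ltW.
apply: le_trans tmin; rewrite leNgt; apply/negP => Wc.
have c0' : 0 < c.
  by rewrite lt_def c0 andbT; apply: contraTneq Wc => ->; rewrite -leNgt.
have mc s : 0 <= s <= c -> W c <= W s.
  by move=> /andP[s0 sc]; apply: cmin; rewrite in_itv/= s0 (le_trans sc).
have r1 := rl_nonpos_at_min p01 c0' cw ww WP mc.
have r2 := rl_nonpos_at_min q01 c0' cw ww WP mc.
have r3 : b * W c < 0 by rewrite pmulr_rlt0.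
have r4 : a * rl q w c <= 0 by rewrite mulr_ge0_le0.
have key (x y z : R) : x <= 0 -> y <= 0 -> z < 0 -> x + y + z < 0 by lra.
by have := H c c0'; rewrite leNgt key.
Qed.

Lemma is_derive_shifted_power M r s : - M < s ->
  is_derive (s : R) 1 (fun v => (M + v) `^ r) (r * (M + s) `^ (r - 1)).
Proof.
move=> Ms; have Ms0 : 0 < M + s by rewrite addrC -[M]opprK subr_gt0.
have h := is_derive1_powR r Ms0.
have h' : is_derive (s : R) (1 : R) (fun v : R => M + v) 1.
  by rewrite -[X in is_derive _ _ _ X]add0r; exact: is_deriveD.
have := @is_derive1_comp R (fun y => y `^ r) (fun v : R => M + v) s _ _ h h'.
by rewrite mulr1.
Qed.

Lemma shifted_power_within M r : 0 < M ->
  {within `[0, +oo[, continuous (fun s => (M + s) `^ r)}.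
Proof.
move=> M0; apply: continuous_in_subspaceT => s.
rewrite inE/= in_itv/= andbT => s0.
have Ms : - M < s by rewrite (lt_le_trans _ s0)// oppr_lt0.
exact: (is_derive_cont (is_derive_shifted_power r Ms)).
Qed.

Lemma shifted_power_causal M r : 0 < M -> causal (ext (fun s : R => (M + s) `^ r)).
Proof. by move=> M0; apply: ext_causal; exact: shifted_power_within. Qed.

Lemma conv1_shifted_power m M t : 0 < m < 1 -> 0 < M -> 0 <= t ->
  conv 1 (ext (fun s => (M + s) `^ (- m))) t <= (M + t) `^ (1 - m) / (1 - m).
Proof.
move=> /andP[m0 m1] M0 t0.
pose F s := (1 - m)^-1 *: (M + s) `^ (1 - m).
have m1' : 0 < 1 - m by rewrite subr_gt0.
have dF s : - M < s -> is_derive (s : R) 1 F ((M + s) `^ (- m)).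
  move=> /(is_derive_shifted_power (1 - m)) h.
  apply: is_derive_eq; rewrite -[LHS]/(_ * _) mulrA mulVf ?gt_eqF// mul1r.
  by congr (_ `^ _); ring.
have Ms s : 0 <= s -> - M < s by move=> s0; rewrite (lt_le_trans _ s0)// oppr_lt0.
have cf := shifted_power_causal (- m) M0.
have -> : conv 1 (ext (fun s => (M + s) `^ (- m))) t = F t - F 0.
  move: t0; rewrite le_eqVlt => /predU1P[<-|t0]; first by rewrite conv_le0// subrr.
  rewrite conv1E//.
  have -> : \int[mu]_(s in `]-oo, t]) ext (fun s => (M + s) `^ (- m)) s =
      \int[mu]_(s in `[0, t]) (M + s) `^ (- m).
    rewrite Rintegral_mkcond [RHS]Rintegral_mkcond; apply: eq_Rintegral => s _.
    rewrite !patchE !mem_setE !in_itv/= /ext.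
    by case: (leP 0 s) => s0 //=; case: ifP.
  rewrite /Rintegral (@continuous_FTC2 _ _ F)//.
  - by apply: within0y_seg => //; exact: shifted_power_within.
  - split.
    + by move=> s; rewrite in_itv/= => /andP[/ltW/Ms/dF[]].
    + exact/cvg_at_right_filter/is_derive_cont/dF/Ms.
    + exact/cvg_at_left_filter/is_derive_cont/dF/Ms/ltW.
  - by move=> s; rewrite in_itv/= => /andP[/ltW/Ms/dF[] _ + _]; rewrite derive1E.
rewrite lerBlDr -[leLHS]addr0 lerD//; first by rewrite /F -[leLHS]/(_ * _) mulrC.
by rewrite mulr_ge0 ?invr_ge0 ?powR_ge0// ltW.
Qed.

(** The integrand is split according to which of t - s and M + s is at least half
    of M + t; that factor is then a constant times a power of M + t. What matters
    later is that the constant does not depend on M. *)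
Lemma conv_shifted_power p m : 0 < p <= 1 -> 0 < m < 1 ->
  exists2 C, 0 < C & forall M t, 0 < M -> 0 <= t ->
    conv p (ext (fun s => (M + s) `^ (- m))) t <= C * (M + t) `^ (p - m).
Proof.
move=> /andP[p0 p1] m01; have /andP[m0 m1] := m01.
have m1' : 0 < 1 - m by rewrite subr_gt0.
pose C1 := (2^-1 `^ (p - 1)) / (1 - m).
pose C2 := (2^-1 `^ (- m)) / p.
have C10 : 0 < C1 by rewrite divr_gt0 ?powR_gt0.
have C20 : 0 < C2 by rewrite divr_gt0 ?powR_gt0.
exists (C1 + C2) => [|M t M0 t0]; first by rewrite addr_gt0.
pose f s := (M + s) `^ (- m).
have cf : causal (ext f) by exact: shifted_power_causal.
pose tau := M + t; have tau0 : 0 < tau by rewrite ltr_wpDr.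
pose h := tau * 2^-1; have h0 : 0 < h by rewrite mulr_gt0.
have tn0 : tau != 0 by rewrite gt_eqF.
have step : conv p (ext f) t <=
    h `^ (p - 1) * conv 1 (ext f) t + h `^ (- m) * conv p (ext (cst 1)) t.
  rewrite -!convZ//; last exact: ext1_causal.
  apply: conv_le_split => //; [exact: causalZ|exact/causalZ/ext1_causal|].
  move=> s /andP[s0 st]; rewrite !ext_ge0// mulr1 !ker_gt0 ?subr_gt0//.
  rewrite subrr powRr0 mul1r.
  have [hs|sh] := leP h (t - s).
    rewrite ler_wpDr ?mulr_ge0 ?powR_ge0//.
    by rewrite ler_wpM2r ?powR_ge0// powR_le_neg// subr_le0.
  rewrite ler_wpDl ?mulr_ge0 ?powR_ge0//.
  rewrite ler_wpM2l ?powR_ge0// powR_le_neg// ?oppr_le0 ?ltW//.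
  by move: sh; rewrite /h /tau; lra.
apply: le_trans step _.
have t1 : h `^ (p - 1) * conv 1 (ext f) t <= C1 * tau `^ (p - m).
  apply: le_trans (ler_wpM2l (powR_ge0 _ _) (conv1_shifted_power m01 M0 t0)) _.
  rewrite -/tau /h powRM// ?(ltW tau0)// /C1.
  rewrite (_ : p - m = (p - 1) + (1 - m)); last by ring.
  rewrite [tau `^ (p - 1 + _)]powRD ?tn0 ?implybT//.
  by rewrite le_eqVlt; apply/orP; left; apply/eqP; ring.
have t2 : h `^ (- m) * conv p (ext (cst 1)) t <= C2 * tau `^ (p - m).
  rewrite conv_unit// /h powRM// ?(ltW tau0)// /C2.
  rewrite (_ : p - m = - m + p); last by ring.
  rewrite [tau `^ (- m + _)]powRD ?tn0 ?implybT//.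
  have tp : t `^ p <= tau `^ p by rewrite ge0_ler_powR// ?nnegrE ?(ltW p0)// ?(ltW tau0)// /tau; lra.
  have -> : tau `^ (- m) * 2^-1 `^ (- m) * (t `^ p / p) = (2^-1 `^ (- m) / p * tau `^ (- m)) * t `^ p by ring.
  by rewrite mulrA ler_wpM2l// mulr_ge0 ?powR_ge0// divr_ge0 ?powR_ge0// ltW.
by rewrite mulrDl lerD.
Qed.

End riemann_liouville.

(** * The integrated equation *)

Section integrated.
Context {R : realType}.
Implicit Types (p q t s u z a b alpha beta : R) (f g w x F : R -> R).

Lemma conv_cvg0 p f : 0 < p -> causal f -> conv p f t @[t --> 0^'+] --> (0 : R).
Proof.
move=> p0 cf; have [M M0 fM] := causal_bound 1 cf.
have lim0 : M / p * t `^ p @[t --> 0^'+] --> (0 : R).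
  have : M / p * t `^ p @[t --> 0^'+] --> M / p * 0.
    by apply: cvgMr; exact: powR_cvg0.
  by rewrite mulr0.
have limN : - (M / p * t `^ p) @[t --> 0^'+] --> (0 : R).
  have : - (M / p * t `^ p) @[t --> 0^'+] --> - (0 : R) by exact: cvgN.
  by rewrite oppr0.
apply: (squeeze_cvgr _ limN lim0).
near=> t; rewrite -ler_norml.
have t0 : 0 < t by [].
have t1 : t <= 1 by near: t; exact: nbhs_right_le.
rewrite (_ : _ * _ = M * (t `^ p / p)); last by ring.
apply: (conv_bound p0 cf (ltW t0)) => s /andP[_ st].
by apply: fM; rewrite (le_trans (ltW st)).
Unshelve. all: by end_near. Qed.

Lemma rl_cvg0 p f : 0 <= p -> causal f -> f t @[t --> 0^'+] --> (0 : R) ->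
  rl p f t @[t --> 0^'+] --> (0 : R).
Proof.
move=> p0 cf f0; rewrite /rl; case: eqVneq => // pn0.
have c0 : conv p f t @[t --> 0^'+] --> (0 : R).
  by apply: conv_cvg0 => //; rewrite lt_def pn0.
have : (Gamma p)^-1 * conv p f t @[t --> 0^'+] --> (Gamma p)^-1 * 0 by exact: cvgMr.
by rewrite mulr0.
Qed.

(** Subtracting x(0) makes the extension by zero continuous on the whole line,
    so its primitive is differentiable everywhere, also at 0 and after a
    translation. *)
Definition incr x : R -> R := ext (fun s => x s - x 0).

Lemma within_incr x : {within `[0, +oo[, continuous x} ->
  {within `[0, +oo[, continuous (fun s => x s - x 0)}.
Proof. by move=> cx t; apply: continuousB; [exact: cx|exact: cst_continuous]. Qed.

Lemma incr_causal x : {within `[0, +oo[, continuous x} -> causal (incr x).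
Proof. by move=> cx; apply: ext_causal; exact: within_incr. Qed.

Lemma incr_le0 x t : t <= 0 -> incr x t = 0.
Proof.
rewrite le_eqVlt => /predU1P[->|t0]; last by rewrite /incr ext_lt0.
by rewrite /incr ext_ge0// subrr.
Qed.

Lemma incr_cvg0 x : {within `[0, +oo[, continuous x} ->
  incr x t @[t --> 0^'+] --> (0 : R).
Proof.
move=> cx; have /continuous_within_itvcyP[_] := within_incr cx.
rewrite subrr => h; apply: cvg_trans h; apply: near_eq_cvg.
by near=> t; rewrite /incr ext_ge0//.
Unshelve. all: by end_near. Qed.

Lemma ext_continuous_pos f t : {within `[0, +oo[, continuous f} -> 0 < t ->
  {for t, continuous (ext f)}.
Proof.
move=> cf t0; have ct := within0y_cont cf t0.
rewrite /prop_for /continuous_at ext_ge0 ?(ltW t0)//.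
apply: cvg_trans ct; apply: near_eq_cvg; near=> s.
rewrite ext_ge0// ltW//; near: s; exact: lt_nbhsr.
Unshelve. all: by end_near. Qed.

Lemma incr_continuous x : {within `[0, +oo[, continuous x} -> continuous (incr x).
Proof.
move=> cx t; have [t0|t0|t0] := ltgtP t 0.
- rewrite /continuous_at incr_le0 ?(ltW t0)//.
  apply: cvg_near_cst; near=> s.
  by rewrite incr_le0// ltW//; near: s; exact: lt_nbhsl.
- by apply: ext_continuous_pos => //; exact: within_incr.
rewrite t0; apply/left_right_continuousP; rewrite incr_le0//; split; last exact: incr_cvg0.
by apply: cvg_near_cst; near=> s; rewrite incr_le0.
Unshelve. all: by end_near. Qed.

Lemma caputo_primE alpha x t : 0 < alpha -> 0 <= t ->
  caputo_prim alpha x t = rl (1 - alpha) (incr x) t.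
Proof.
move=> a0 t0; rewrite /caputo_prim frac_int_rl//.
by rewrite eq_sym -subr_eq0 opprB addrC subrK gt_eqF.
Qed.

Lemma is_derive_lincomb (A B D E : R -> R) a b (s dA dB dD dE : R) :
  is_derive s 1 A dA -> is_derive s 1 B dB -> is_derive s 1 D dD ->
  is_derive s 1 E dE ->
  is_derive s 1 (fun y => A y + a * B y + b * D y - E y) (dA + a * dB + b * dD - dE).
Proof.
move=> hA hB hD hE.
have -> : (fun y => A y + a * B y + b * D y - E y) = A + a *: B + b *: D - E by [].
exact: (is_deriveB (is_deriveD (is_deriveD hA (is_deriveZ a hB)) (is_deriveZ b hD)) hE).
Qed.

(** The difference of the two sides has derivative 0 on t > 0, by the equation,
    and tends to 0 at 0+, where every term does; so it vanishes. *)
Lemma integrated_equation alpha beta a b (x0 : R) g F x :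
  0 < beta -> beta < alpha -> alpha <= 1 ->
  is_solution alpha beta a b x0 g x -> cont_caputo_diff alpha F ->
  (forall t, 0 <= t -> g t = caputo alpha F t) ->
  forall t, rl (1 - alpha) (incr x) t + a * rl (1 - beta) (incr x) t +
    b * conv 1 (ext x) t = rl (1 - alpha) (incr F) t.
Proof.
move=> b0 ba a1 [[cx dx _] _ eqx] [cF dF _] gE t.
have a0 : 0 < alpha by exact: lt_trans ba.
have [t0|t0] := leP t 0.
  have rl0 p (y : R -> R) : {within `[0, +oo[, continuous y} -> rl p (incr y) t = 0.
    move=> cy; rewrite /rl incr_le0//; case: ifP => // _.
    by rewrite conv_le0 ?mulr0//; exact: incr_causal.
  rewrite !rl0// conv_le0//; last exact: ext_causal.
  by rewrite !mulr0 !addr0.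
pose N s := caputo_prim alpha x s + a * caputo_prim beta x s +
  b * conv 1 (ext x) s - caputo_prim alpha F s.
have NE s : 0 < s -> N s = rl (1 - alpha) (incr x) s + a * rl (1 - beta) (incr x) s +
    b * conv 1 (ext x) s - rl (1 - alpha) (incr F) s.
  by move=> s0; rewrite /N !caputo_primE// ltW.
have dN s : 0 < s -> is_derive (s : R) 1 N 0.
  move=> s0; have [dbx] := eqx s s0.
  rewrite gE ?(ltW s0)// /caputo s0 => eqs.
  have h1 : is_derive (s : R) 1 (caputo_prim alpha x) ((caputo_prim alpha x)^`()%classic s).
    by apply: DeriveDef; [exact: dx|rewrite derive1E].
  have h2 : is_derive (s : R) 1 (caputo_prim beta x) ((caputo_prim beta x)^`()%classic s).
    by apply: DeriveDef; [exact: dbx|rewrite derive1E].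
  have h3 : is_derive (s : R) 1 (caputo_prim alpha F) ((caputo_prim alpha F)^`()%classic s).
    by apply: DeriveDef; [exact: dF|rewrite derive1E].
  have h4 : is_derive (s : R) 1 (conv 1 (ext x)) (x s).
    rewrite -(ext_ge0 x (ltW s0)); apply: is_derive_conv1; first exact: ext_causal.
    exact: ext_continuous_pos.
  have -> : 0 = (caputo_prim alpha x)^`()%classic s + a * (caputo_prim beta x)^`()%classic s +
      b * x s - (caputo_prim alpha F)^`()%classic s by rewrite eqs; ring.
  exact: is_derive_lincomb h1 h2 h4 h3.
have N0 : N s @[s --> 0^'+] --> (0 : R).
  have : rl (1 - alpha) (incr x) s + a * rl (1 - beta) (incr x) s +
      b * conv 1 (ext x) s - rl (1 - alpha) (incr F) s @[s --> 0^'+] --> 0 + a * 0 + b * 0 - 0.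
    apply: cvgB; last by apply: rl_cvg0; [lra|exact: incr_causal|exact: incr_cvg0].
    apply: cvgD; last by apply: cvgMr; apply: conv_cvg0 => //; exact: ext_causal.
    apply: cvgD; first by apply: rl_cvg0; [lra|exact: incr_causal|exact: incr_cvg0].
    by apply: cvgMr; apply: rl_cvg0; [lra|exact: incr_causal|exact: incr_cvg0].
  rewrite !mulr0 !addr0 subr0 => h.
  by apply: cvg_trans h; apply: near_eq_cvg; near=> s; rewrite NE.
suff : N t = 0 by rewrite NE// => /eqP; rewrite subr_eq0 => /eqP.
have Nc : N s @[s --> 0^'+] --> N t.
  apply: cvg_near_cst; near=> s.
  have s0 : 0 < s by [].
  have st : s < t by near: s; exact: nbhs_right_lt.
  have [||c _] := @MVT R N (fun=> 0) s t st.
  - by move=> y; rewrite in_itv/= => /andP[sy _]; apply: dN; exact: lt_trans sy.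
  - apply: continuous_in_subspaceT => y; rewrite inE/= in_itv/= => /andP[sy _].
    exact/is_derive_cont/dN/(lt_le_trans s0).
  by rewrite mul0r; move: (N t) (N s) => u v uv; lra.
exact: (cvg_unique _ Nc N0).
Unshelve. all: by end_near. Qed.

End integrated.

(** * The decay rate *)

Section decay.
Context {R : realType}.
Implicit Types (p q t s u z a b alpha beta gam M : R) (f g w x F : R -> R).

Lemma rl_shifted_power p gam : 0 <= p -> 0 < gam -> p + gam < 1 ->
  exists2 C, 0 < C & forall M t, 0 < M -> 0 <= t ->
    rl p (ext (fun s => (M + s) `^ (- (p + gam)))) t <= C * (M + t) `^ (- gam).
Proof.
move=> p0 g0 pg1; have [->|pn0] := eqVneq p 0.
  by exists 1 => // M t M0 t0; rewrite /rl eqxx ext_ge0// add0r mul1r.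
have p0' : 0 < p by rewrite lt_def pn0.
have Gp : 0 < Gamma p by apply: Gamma_gt0; lra.
have [||C C0 HC] := @conv_shifted_power R p (p + gam); [lra|lra|].
exists ((Gamma p)^-1 * C) => [|M t M0 t0]; first by rewrite mulr_gt0 ?invr_gt0.
rewrite /rl (negbTE pn0) -mulrA ler_wpM2l ?invr_ge0 ?(ltW Gp)//.
by have := HC M t M0 t0; rewrite (_ : p - (p + gam) = - gam)//; ring.
Qed.

(** The mean value theorem gives an intermediate point c in [s - e, s]; since
    e <= 1, 1 + c is at least half of 1 + s, whence the factor 2^-1 `^ r. *)
Lemma incr_diff_le F dF C r e s : {within `[0, +oo[, continuous F} ->
  (forall t, 0 < t -> is_derive (t : R) 1 F (dF t)) ->
  0 <= C -> r <= 0 -> (forall t, 0 < t -> `|dF t| <= C * (1 + t) `^ r) ->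
  0 < e <= 1 -> 0 <= s ->
  `|incr F s - incr F (s - e)| <= e * (C * 2^-1 `^ r * (1 + s) `^ r).
Proof.
move=> cF HF C0 r0 dFle /andP[e0 e1]; rewrite le_eqVlt => /predU1P[<-|s0].
  rewrite !incr_le0 ?sub0r ?oppr_le0 ?(ltW e0)// oppr0 normr0.
  by rewrite !mulr_ge0 ?powR_ge0// ltW.
pose l := Num.max 0 (s - e).
have l0 : 0 <= l by rewrite le_max lexx.
have ls : l < s by rewrite gt_max s0/= ltrBlDr ltrDl.
have sl : s - l <= e by rewrite lerBlDr -lerBlDl le_max lexx orbT.
have [||c] := @MVT R F dF l s ls.
- by move=> y; rewrite in_itv/= => /andP[ly _]; apply: HF; exact: le_lt_trans ly.
- exact: within0y_seg.
rewrite in_itv/= => /andP[lc cs] Fc.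
have -> : incr F s - incr F (s - e) = F s - F l.
  rewrite {1}/incr ext_ge0 ?(ltW s0)// /l.
  have [se|se] := leP (s - e) 0.
    by rewrite incr_le0// subr0.
  by rewrite /incr ext_ge0 ?(ltW se)//; ring.
have c0 : 0 < c by exact: le_lt_trans lc.
have sl0 : 0 < s - l by rewrite subr_gt0.
rewrite Fc normrM (gtr0_norm sl0) mulrC ler_pM ?(ltW sl0)//.
apply: le_trans (dFle c c0) _; rewrite -mulrA ler_wpM2l//.
rewrite -powRM ?invr_ge0//; last by lra.
apply: powR_le_neg => //; first by rewrite mulr_gt0 ?invr_gt0//; lra.
have : s - e <= l by rewrite le_max lexx orbT.
lra.
Qed.

Lemma incr_add x : ext x = fun s => incr x s + x 0 * ext (cst 1) s.
Proof.
apply/funext => s; rewrite /incr /ext; case: ifP => _; last by rewrite mulr0 addr0.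
by rewrite mulr1 subrK.
Qed.

(** Only windows reaching below 0 see a mean other than 1; the deviation is the
    start-up error of the averaged equation. *)
Lemma unit_mean e t : 0 < e -> 0 < t ->
  exists2 m, (conv 1 (ext (cst 1)) t - conv 1 (ext (cst (1 : R))) (t - e)) / e = m &
  0 <= m <= 1 /\ (e <= t -> m = 1).
Proof.
move=> e0 t0; eexists; first by reflexivity.
have c1 s : 0 <= s -> conv 1 (ext (cst 1)) s = s.
  by move=> s0; rewrite conv_unit// powRr1// divr1.
rewrite (c1 t (ltW t0)).
have [et|te] := leP e t.
  by rewrite c1 ?subr_ge0// opprB addrCA subrr addr0 divff ?gt_eqF// ler01 lexx.
rewrite conv_le0 ?subr_le0 ?(ltW te)//; last exact: ext1_causal.
rewrite subr0; split => //.
by rewrite divr_ge0 ?(ltW t0) ?(ltW e0)//= ler_pdivrMr// mul1r ltW.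
Qed.

(** One threshold M serves all exponents r >= beta at once, which allows the two
    fractional terms to be absorbed simultaneously. *)
Lemma negative_power_small beta D b : 0 < beta -> 0 <= D -> 0 < b ->
  exists2 M, 1 <= M & forall r, beta <= r -> D * M `^ (- r) <= b.
Proof.
move=> beta0 D0 b0; pose M := 1 + (D / b) `^ beta^-1.
have M1 : 1 <= M by rewrite lerDl powR_ge0.
have M0 : 0 < M by exact: lt_le_trans M1.
exists M => // r br.
apply: (@le_trans _ _ (D * M `^ (- beta))).
  by rewrite ler_wpM2l// ler_powR// lerN2.
rewrite powRN ler_pdivrMr ?powR_gt0// mulrC -ler_pdivrMr//.
have -> : D / b = ((D / b) `^ beta^-1) `^ beta.
  by rewrite -powRrM mulVf ?gt_eqF// powRr1// divr_ge0// ltW.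
by rewrite ge0_ler_powR ?nnegrE ?powR_ge0 ?(ltW M0) ?(ltW beta0)// lerDr.
Qed.

End decay.

Section solution_bound.
Context {R : realType}.
Implicit Types (p q t s u z a b alpha beta gam M : R) (f g w x F : R -> R).

Lemma within_cst_mul k f : {within `[0, +oo[, continuous f} ->
  {within `[0, +oo[, continuous (fun s => k * f s)}.
Proof. by move=> cf t; apply: continuousM; [exact: cst_continuous|exact: cf]. Qed.

Lemma within_add f g : {within `[0, +oo[, continuous f} ->
  {within `[0, +oo[, continuous g} ->
  {within `[0, +oo[, continuous (fun s => f s + g s)}.
Proof. by move=> cf cg t; apply: continuousD; [exact: cf|exact: cg]. Qed.

(** The derivative of (M + s)^(-gam) is split as a power of order p + gam, whose
    integral of order p is comparable to (M + t)^(-gam), times a power bounded by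
    M^(-(1 - p)), which is small for large M. *)
Lemma rl_deriv_shifted_power p gam : 0 <= p -> 0 < gam -> p + gam < 1 ->
  exists2 C, 0 <= C & forall M t, 0 < M -> 0 <= t ->
    `|rl p (ext (fun s => - gam * (M + s) `^ (- gam - 1))) t| <=
    C * M `^ (- (1 - p)) * (M + t) `^ (- gam).
Proof.
move=> p0 g0 pg1; have [C C0 HC] := rl_shifted_power p0 g0 pg1.
exists (gam * C) => [|M t M0 t0]; first by rewrite mulr_ge0 ?ltW.
pose k := gam * M `^ (- (1 - p)).
have k0 : 0 <= k by rewrite mulr_ge0 ?powR_ge0// ltW.
have ck := shifted_power_causal (- (p + gam)) M0.
apply: (@le_trans _ _ (rl p (fun s => k * ext (fun s => (M + s) `^ (- (p + gam))) s) t)).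
  apply: rl_norm_le => //.
  - by apply: ext_causal; apply: within_cst_mul; exact: shifted_power_within.
  - exact: causalZ.
  move=> s /andP[s0 _]; rewrite !ext_ge0// normrM normrN (gtr0_norm g0) ger0_norm ?powR_ge0//.
  rewrite /k -mulrA ler_wpM2l ?(ltW g0)//.
  have Ms0 : 0 < M + s by rewrite ltr_wpDr.
  have Msn : M + s != 0 by rewrite gt_eqF.
  rewrite (_ : - gam - 1 = - (1 - p) + - (p + gam)); last by ring.
  rewrite [leLHS]powRD ?Msn ?implybT// ler_wpM2r ?powR_ge0// powR_le_neg//.
    by rewrite lerDl.
  by rewrite oppr_le0; lra.
rewrite rlZ// /k.
have -> : gam * C * M `^ (- (1 - p)) * (M + t) `^ (- gam) =
  gam * M `^ (- (1 - p)) * (C * (M + t) `^ (- gam)) by ring.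
by rewrite ler_wpM2l// HC.
Qed.

(** The fractional terms carry factors M^(-(1 - p)) and M^(-(1 - q)); for large M
    each costs at most a quarter of b (M + t)^(-gam). *)
Lemma supersolution p q a b gam : 0 <= p -> p <= q -> 0 < gam -> q + gam < 1 ->
  0 < a -> 0 < b ->
  exists2 M, 1 <= M & forall t, 0 <= t ->
    let dy := ext (fun s => - gam * (M + s) `^ (- gam - 1)) in
    b / 2 * (M + t) `^ (- gam) <=
    rl p dy t + a * rl q dy t + b * (M + t) `^ (- gam).
Proof.
move=> p0 pq g0 qg1 a0 b0.
have q0 : 0 <= q by exact: le_trans pq.
have pg1 : p + gam < 1 by lra.
have [C C0 HC] := rl_deriv_shifted_power p0 g0 pg1.
have [D D0 HD] := rl_deriv_shifted_power q0 g0 qg1.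
have q1 : 0 < 1 - q by lra.
have b4 : 0 < b / 4 by rewrite divr_gt0.
have CD0 : 0 <= C + a * D by rewrite addr_ge0// mulr_ge0// ltW.
have [M M1 HM] := negative_power_small q1 CD0 b4.
exists M => // t t0; have M0 : 0 < M by exact: lt_le_trans M1.
set dy := ext _ => /=.
have := HC M t M0 t0; have := HD M t M0 t0; rewrite -/dy.
set y := (M + t) `^ (- gam); have y0 : 0 <= y by exact: powR_ge0.
have hp : (C + a * D) * M `^ (- (1 - p)) <= b / 4 by apply: HM; lra.
have hq : (C + a * D) * M `^ (- (1 - q)) <= b / 4 by exact: HM.
have h1 : C * M `^ (- (1 - p)) <= b / 4.
  by apply: le_trans hp; rewrite ler_wpM2r ?powR_ge0// lerDl mulr_ge0// ltW.
have h2 : a * D * M `^ (- (1 - q)) <= b / 4.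
  by apply: le_trans hq; rewrite ler_wpM2r ?powR_ge0// lerDr.
move=> /lerNnormlW hv /lerNnormlW hu; move: hv hu.
have i1 : C * M `^ (- (1 - p)) * y <= b / 4 * y by rewrite ler_wpM2r.
have i2 : a * D * M `^ (- (1 - q)) * y <= b / 4 * y by rewrite ler_wpM2r.
move: (rl p dy t) (rl q dy t) => u v hv hu.
have i3 : - (a * D * M `^ (- (1 - q)) * y) <= a * v.
  rewrite (_ : - _ = a * - (D * M `^ (- (1 - q)) * y)); last by ring.
  by rewrite ler_pM2l.
lra.
Qed.

(** The bound has to be uniform in the window length e, because e tends to 0 at
    the end. *)
Lemma forcing_bound p gam C F M : 0 <= p -> 0 < gam -> p + gam < 1 -> 1 <= M ->
  0 <= C -> {within `[0, +oo[, continuous F} ->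
  (forall e s, 0 < e <= 1 -> 0 <= s ->
    `|incr F s - incr F (s - e)| <= e * (C * (1 + s) `^ (- (p + gam)))) ->
  exists2 A, 0 <= A & forall e t, 0 < e <= 1 -> 0 <= t ->
    `|(rl p (incr F) t - rl p (incr F) (t - e)) / e| <= A * (M + t) `^ (- gam).
Proof.
move=> p0 g0 pg1 M1 C0 cF HF; have M0 : 0 < M by exact: lt_le_trans M1.
have [D D0 HD] := rl_shifted_power p0 g0 pg1.
pose k := C * M `^ (p + gam).
have k0 : 0 <= k by rewrite mulr_ge0 ?powR_ge0.
exists (k * D) => [|e t /andP[e0 e1] t0]; first exact: mulr_ge0 k0 (ltW D0).
have cI := incr_causal cF.
have cS := causal_shift (ltW e0) cI.
have -> : (rl p (incr F) t - rl p (incr F) (t - e)) / e =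
    rl p (fun s => e^-1 * (incr F s + -1 * incr F (s - e))) t.
  rewrite rlZ//; last by apply: causalD => //; exact: causalZ.
  have cZ := causalZ (-1) cS.
  by rewrite (rlD _ p0 cI cZ) (rlZ _ _ p0 cS) (rl_shift _ _ _ cI) mulN1r mulrC.
have ck := shifted_power_causal (- (p + gam)) M0.
apply: (@le_trans _ _ (rl p (fun s => k * ext (fun s => (M + s) `^ (- (p + gam))) s) t)).
  apply: rl_norm_le => //; [|exact: causalZ|].
    by apply: causalZ; apply: causalD => //; exact: causalZ.
  move=> s /andP[s0 _]; rewrite ext_ge0// mulN1r normrM gtr0_norm ?invr_gt0//.
  rewrite mulrC ler_pdivrMr// mulrC.
  apply: le_trans (HF e s _ s0) _; first by rewrite e0.
  rewrite ler_wpM2l ?(ltW e0)// /k -mulrA ler_wpM2l//.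
  have s1 : 0 < 1 + s by rewrite ltr_wpDr.
  rewrite -[X in _ <= X * _]invrK -powRN -ler_pdivrMl ?invr_gt0 ?powR_gt0//.
  rewrite invrK -powRM ?(ltW M0) ?(ltW s1)//.
  apply: powR_le_neg; [by rewrite ltr_wpDr| |by rewrite oppr_le0; lra].
  by rewrite mulrDr mulr1 lerD2l ler_peMl.
rewrite rlZ// -mulrA ler_wpM2l//.
by apply: le_trans (HD M t M0 t0) _.
Qed.

Lemma incr_shift_within x e : {within `[0, +oo[, continuous x} ->
  {within `[0, +oo[, continuous (fun s => incr x s + -1 * incr x (s - e))}.
Proof.
move=> cx; apply: continuous_subspaceT => s; apply: continuousD.
  exact: incr_continuous.
apply: continuousM; first exact: cst_continuous.
apply: (@continuous_comp _ _ _ (fun s => s - e) (incr x)); last exact: incr_continuous.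
by apply: continuousB; [|exact: cst_continuous].
Qed.

Lemma is_derive_conv1_incr x t : {within `[0, +oo[, continuous x} ->
  is_derive (t : R) 1 (conv 1 (incr x)) (incr x t).
Proof.
move=> cx; apply: is_derive_conv1; first exact: incr_causal.
exact: incr_continuous.
Qed.

Lemma is_derive_conv1_shift x e t : {within `[0, +oo[, continuous x} ->
  is_derive (t : R) 1 (fun s => conv 1 (incr x) (s - e)) (incr x (t - e)).
Proof.
move=> cx; have h := is_derive_conv1_incr (t - e) cx.
have h' : is_derive (t : R) (1 : R) (fun v : R => v - e) 1.
  by rewrite -[X in is_derive _ _ _ X]subr0; exact: is_deriveB.
have := @is_derive1_comp R (conv 1 (incr x)) (fun v : R => v - e) t _ _ h h'.
by rewrite mulr1.
Qed.

(** The start-up error lives on t <= e <= 1, so it can be dominated by a multiple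
    of the supersolution. *)
Lemma startup_term b gam M (c m s : R) : 0 < b -> 0 < gam -> 0 < M ->
  0 <= m <= 1 -> 0 <= s <= 1 ->
  `|b * c * (1 - m)| <= b * `|c| * (M + 1) `^ gam * (M + s) `^ (- gam).
Proof.
move=> b0 g0 M0 /andP[m0 m1] /andP[s0 s1].
have Ms : 0 < M + s by rewrite ltr_wpDr.
have bc : 0 <= b * `|c| by rewrite mulr_ge0// ltW.
rewrite powRN ler_pdivlMr ?powR_gt0// !normrM (gtr0_norm b0).
have m1' : 0 <= 1 - m by rewrite subr_ge0.
rewrite (ger0_norm m1'); apply: ler_pM; rewrite ?powR_ge0//.
- exact: mulr_ge0.
- by rewrite ler_piMr// lerBlDr lerDl.
- by rewrite ge0_ler_powR ?nnegrE ?(ltW g0) ?(ltW Ms)// ?lerD2l// addr_ge0// ltW.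
Qed.

Lemma lower_bound_combine (k b1 b2 c1 c2 d : R) : - c1 <= b1 -> - c2 <= b2 ->
  d <= k -> c1 + c2 <= d -> 0 <= k + b1 + b2.
Proof. lra. Qed.

(** The operator applied to the barrier plus the averaged solution: the averaged
    equation replaces the solution terms by the averaged forcing and the start-up
    error. *)
Lemma mean_algebra (K sg e a b x0 y py qy P P' Q Q' J J' U U' G G' : R) :
  e != 0 -> P + a * Q + b * (J + x0 * U) = G ->
  P' + a * Q' + b * (J' + x0 * U') = G' ->
  K * py + sg / e * (P - P') + a * (K * qy + sg / e * (Q - Q')) +
    b * (K * y + sg * (x0 + (J - J') / e)) =
  K * (py + a * qy + b * y) + sg * ((G - G') / e) +
    sg * (b * x0 * (1 - (U - U') / e)).
Proof. by move=> e0 <- <-; field. Qed.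

(** The comparison principle needs the derivative of the function compared, and
    x itself need not be differentiable. The mean of its increment X over a window
    of length e is, with derivative (X(t) - X(t - e)) / e, and x(0) plus this mean
    satisfies the difference of the integrated equations at t and t - e, divided
    by e, up to the start-up error. The forcing of that equation is dominated by
    the supersolution K (M + t)^(-gam), with K and M independent of e. The sign sg gives
    the upper and the lower bound together. *)
Lemma mean_bound alpha beta a b gam C x F :
  0 < beta -> beta < alpha -> alpha <= 1 -> 0 < a -> 0 < b ->
  0 < gam -> gam < beta ->
  {within `[0, +oo[, continuous x} -> {within `[0, +oo[, continuous F} ->
  0 <= C ->
  (forall e s, 0 < e <= 1 -> 0 <= s ->
    `|incr F s - incr F (s - e)| <= e * (C * (1 + s) `^ (- (1 - alpha + gam)))) ->
  (forall t, rl (1 - alpha) (incr x) t + a * rl (1 - beta) (incr x) t +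
    b * conv 1 (ext x) t = rl (1 - alpha) (incr F) t) ->
  exists K M, [/\ 0 <= K, 0 < M & forall (sg e t : R), `|sg| = 1 -> 0 < e <= 1 -> 0 <= t ->
    0 <= K * (M + t) `^ (- gam) +
      sg * (x 0 + (conv 1 (incr x) t - conv 1 (incr x) (t - e)) / e)].
Proof.
move=> beta0 ba a1 a0 b0 g0 gb cx cF C0 HF E.
have p0 : 0 <= 1 - alpha by lra.
have pq : 1 - alpha <= 1 - beta by lra.
have pg1 : 1 - alpha + gam < 1 by lra.
have qg1 : 1 - beta + gam < 1 by lra.
have [M M1 HM] := supersolution p0 pq g0 qg1 a0 b0.
have M0 : 0 < M by exact: lt_le_trans M1.
have [A A0 HA] := forcing_bound p0 g0 pg1 M1 C0 cF HF.
move: p0 pq pg1 qg1 HM HA E.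
set p := 1 - alpha; set q := 1 - beta => p0 pq pg1 qg1 HM HA E.
have q0 : 0 <= q by exact: le_trans pq.
have q1 : q < 1 by rewrite /q; lra.
pose A2 := b * `|x 0| * (M + 1) `^ gam.
have A20 : 0 <= A2 by rewrite !mulr_ge0 ?powR_ge0// ltW.
(* The first summand absorbs forcing and start-up error, the second one makes the
   barrier exceed the initial value. *)
pose K := 2 * (A + A2) / b + `|x 0| * M `^ gam.
have K1 : 0 <= `|x 0| * M `^ gam by rewrite mulr_ge0 ?powR_ge0.
have K2 : 0 <= 2 * (A + A2) / b by rewrite divr_ge0 ?(ltW b0)// mulr_ge0// addr_ge0.
have K0 : 0 <= K by rewrite addr_ge0.
exists K, M; split => // sg e t sg1 /andP[e0 e1].
pose dy := ext (fun s => - gam * (M + s) `^ (- gam - 1)).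
have wdy : {within `[0, +oo[, continuous (fun s => - gam * (M + s) `^ (- gam - 1))}.
  by apply: within_cst_mul; exact: shifted_power_within.
have cdy : causal dy by exact: ext_causal.
pose d s := incr x s + -1 * incr x (s - e).
have cI := incr_causal cx; have cS := causal_shift (ltW e0) cI.
have cd : causal d by apply: causalD => //; exact: causalZ.
pose w s := K * dy s + sg / e * d s.
pose W s := K * (M + s) `^ (- gam) +
  sg * (x 0 + (conv 1 (incr x) s - conv 1 (incr x) (s - e)) / e).
rewrite -/(W t).
have dW s : - M < s -> is_derive (s : R) 1 W
    (K * (- gam * (M + s) `^ (- gam - 1)) + sg / e * d s).
  move=> Ms; have h1 := is_derive_shifted_power (- gam) Ms.
  have h2 := is_derive_conv1_incr s cx; have h3 := is_derive_conv1_shift e s cx.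
  have -> : W = K *: (fun s => (M + s) `^ (- gam)) + (cst (sg * x 0) +
    (sg / e) *: (conv 1 (incr x) - (fun s => conv 1 (incr x) (s - e)))).
    apply/funext => v; rewrite /W mulrDr; congr (_ + (_ + _)).
    by rewrite mulrA mulrAC.
  have -> : d s = incr x s - incr x (s - e) by rewrite /d mulN1r.
  rewrite -[sg / e * _]add0r.
  exact: (is_deriveD (is_deriveZ K h1) (is_deriveD (is_derive_cst _ _ _) (is_deriveZ (sg / e) (is_deriveB h2 h3)))).
have Ms s : 0 <= s -> - M < s by move=> s0; rewrite (lt_le_trans _ s0)// oppr_lt0.
have p01 : 0 <= p < 1 by rewrite p0 (le_lt_trans pq).
have q01 : 0 <= q < 1 by rewrite q0.
have cw : causal w by apply: causalD; exact: causalZ.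
have ww : {within `[0, +oo[, continuous w}.
  pose w' s := K * (- gam * (M + s) `^ (- gam - 1)) + sg / e * d s.
  have ew : {in `[0, +oo[%classic, w' =1 w}.
    move=> s; rewrite inE/= in_itv/= andbT => s0.
    by rewrite /w /dy ext_ge0.
  apply: (subspace_eq_continuous ew).
  apply: within_add; first exact: within_cst_mul.
  by apply: within_cst_mul; exact: incr_shift_within.
have cW0 : {for 0, continuous W} := is_derive_cont (dW 0 (Ms 0 (lexx 0))).
have WP : primitive W w.
  split; last exact: (cvg_at_right_filter cW0).
  move=> s s0; rewrite {1}/w {1}/dy (ext_ge0 _ (ltW s0)).
  exact: (dW s (Ms s (ltW s0))).
have W0 : 0 <= W 0.
  rewrite /W addr0 !conv_le0 ?sub0r ?oppr_le0 ?(ltW e0)// oppr0 mul0r addr0.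
  have : `|sg * x 0| <= K * M `^ (- gam).
    rewrite normrM sg1 mul1r powRN ler_pdivlMr ?powR_gt0//.
    by rewrite /K lerDr.
  by move=> /lerNnormlW; rewrite -subr_ge0 opprK addrC.
apply: (comparison p01 q01 (ltW a0) b0 cw ww WP W0).
move=> s s0; have s0' := ltW s0.
have rw r : 0 <= r -> rl r w s = K * rl r dy s +
    sg / e * (rl r (incr x) s - rl r (incr x) (s - e)).
  move=> r0; rewrite /w rlD//; [|exact: causalZ|exact: causalZ].
  rewrite !rlZ// /d rlD//; last exact: causalZ.
  by rewrite rlZ// rl_shift// mulN1r.
rewrite !rw//.
have [m mE [m01 m1]] := unit_mean e0 s0.
have cE v : conv 1 (ext x) v = conv 1 (incr x) v + x 0 * conv 1 (ext (cst 1)) v.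
  have c1 := ext1_causal (R := R).
  by rewrite [in LHS]incr_add convD ?convZ//; exact: causalZ.
have Es := E s; have Ee := E (s - e); rewrite !cE in Es Ee.
have y1 := HM s s0'; rewrite -/dy/= in y1.
have y2 := HA e s (introT andP (conj e0 e1)) s0'.
have y3 : `|b * x 0 * (1 - m)| <= A2 * (M + s) `^ (- gam).
  have [es|se] := leP e s.
    by rewrite m1// subrr mulr0 normr0 mulr_ge0 ?powR_ge0.
  by apply: startup_term => //; rewrite s0' (le_trans (ltW se)).
have en0 : e != 0 by rewrite gt_eqF.
rewrite /W (mean_algebra K sg ((M + s) `^ (- gam)) (rl p dy s) (rl q dy s) en0 Es Ee) mE.
move: y1 y2 y3; rewrite -/dy.
have yy0 : 0 <= (M + s) `^ (- gam) by exact: powR_ge0.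
move: (rl p dy s + _ + _) (_ / e) (b * x 0 * (1 - m)) yy0.
move: ((M + s) `^ (- gam)) => y S B1 B2 yy0 hS hB1 hB2.
have n1 : - (A * y) <= sg * B1 by apply: lerNnormlW; rewrite normrM sg1 mul1r.
have n2 : - (A2 * y) <= sg * B2 by apply: lerNnormlW; rewrite normrM sg1 mul1r.
have n3 : K * (b / 2 * y) <= K * S by rewrite ler_wpM2l.
have n4 : (A + A2) * y <= K * (b / 2 * y).
  rewrite mulrA ler_wpM2r// /K mulrDl.
  have -> : 2 * (A + A2) / b * (b / 2) = A + A2 by field; exact: lt0r_neq0.
  by rewrite lerDl mulr_ge0// divr_ge0// ltW.
rewrite mulrDl in n4.
exact: lower_bound_combine n1 n2 n3 n4.
Qed.

(** Were the bound violated at t it would be violated on a neighbourhood of t; the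
    mean over a short window ending at t is a value of x in that
    neighbourhood. *)
Lemma solution_decay alpha beta a b gam C x F :
  0 < beta -> beta < alpha -> alpha <= 1 -> 0 < a -> 0 < b ->
  0 < gam -> gam < beta ->
  {within `[0, +oo[, continuous x} -> {within `[0, +oo[, continuous F} ->
  0 <= C ->
  (forall e s, 0 < e <= 1 -> 0 <= s ->
    `|incr F s - incr F (s - e)| <= e * (C * (1 + s) `^ (- (1 - alpha + gam)))) ->
  (forall t, rl (1 - alpha) (incr x) t + a * rl (1 - beta) (incr x) t +
    b * conv 1 (ext x) t = rl (1 - alpha) (incr F) t) ->
  exists K M, [/\ 0 <= K, 0 < M & forall t, 0 <= t -> `|x t| <= K * (M + t) `^ (- gam)].
Proof.
move=> beta0 ba a1 a0 b0 g0 gb cx cF C0 HF E.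
have [K [M [K0 M0 H]]] := mean_bound beta0 ba a1 a0 b0 g0 gb cx cF C0 HF E.
exists K, M; split => // t t0.
have xE : x t = x 0 + incr x t by rewrite /incr ext_ge0// addrC subrK.
rewrite xE leNgt; apply/negP => lt.
have ct : {for t, continuous (fun s => `|x 0 + incr x s|)}.
  apply: (@continuous_comp _ _ _ (fun s => x 0 + incr x s) (fun y => `|y|)).
    by apply: continuousD; [exact: cst_continuous|exact: incr_continuous].
  exact: norm_continuous.
have [e /= e0 be] := cvgr_gt _ ct _ lt.
pose d := Num.min (e / 2) 1.
have d0 : 0 < d by rewrite lt_min ltr01 andbT divr_gt0.
have d1 : d <= 1 by rewrite ge_min lexx orbT.
have de : d <= e / 2 by rewrite ge_min lexx.
have td : t - d < t by rewrite ltrBlDr ltrDl.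
have [||c] := @MVT R (conv 1 (incr x)) (incr x) (t - d) t td.
- by move=> y _; exact: is_derive_conv1_incr.
- apply: continuous_subspaceT => y; exact: is_derive_cont (is_derive_conv1_incr y cx).
rewrite in_itv/= => /andP[c1 c2]; have -> : t - (t - d) = d by ring.
move=> ce.
have : K * (M + t) `^ (- gam) < `|x 0 + incr x c|.
  apply: be; rewrite /ball_/= gtr0_norm ?subr_gt0// ltrBlDr -ltrBlDl.
  apply: lt_trans c1; rewrite ltrD2l ltrN2 (le_lt_trans de)//.
  by rewrite ltr_pdivrMr// ltr_pMr// ltr1n.
apply/negP; rewrite -leNgt ler_norml.
have dd : 0 < d <= 1 by rewrite d0.
have := H 1 d t (normr1 _) dd t0.
have := H (-1) d t _ dd t0; rewrite normrN normr1 => /(_ erefl).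
rewrite ce mulfK ?gt_eqF// mul1r mulN1r => h1 h2.
by rewrite -subr_ge0 opprK addrC h2 -subr_ge0 h1.
Qed.

End solution_bound.

(** * Oscillation *)

Lemma mono_combine (R : realType) (C2 C3 u1 u2 v1 v2 k T1 d e : R) :
  C2 * u1 <= C2 * u2 + C2 * (k * (e - d) * T1) ->
  C3 * v1 <= C3 * v2 + C3 * (k * (e - d) * T1) -> d < e ->
  C2 * u1 + C3 * v1 + ((C2 + C3) * (k * T1) + 1) * d <
  C2 * u2 + C3 * v2 + ((C2 + C3) * (k * T1) + 1) * e.
Proof. nra. Qed.

Lemma lower_bound_algebra (R : realType) (C1 C2 D th Ft F0 xt x0 y : R) :
  0 < C1 -> 0 <= C2 -> 0 <= D -> 0 < 1 + th -> 0 <= xt -> 0 <= y ->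
  0 <= C1 * (Ft - F0) + - C1 * (xt - x0) +
    C2 * x0 / (1 + th) * ((1 + th) * y) - - (D + 1) * 1 ->
  - ((`|F0| + `|x0| + (C2 * `|x0| + D + 1) / C1) * (1 + y)) <= Ft.
Proof.
move=> C10 C20 D0 th0 xt0 y0.
have -> : C2 * x0 / (1 + th) * ((1 + th) * y) = C2 * x0 * y.
  by field; exact: lt0r_neq0.
move=> H.
have h1 : F0 + xt - x0 - (C2 * x0 * y + D + 1) / C1 <= Ft.
  rewrite -subr_ge0 -(pmulr_rge0 _ C10).
  suff -> : C1 * (Ft - (F0 + xt - x0 - (C2 * x0 * y + D + 1) / C1)) =
    C1 * (Ft - F0) + - C1 * (xt - x0) + C2 * x0 * y - - (D + 1) * 1 by [].
  by field; exact: lt0r_neq0.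
apply: le_trans h1.
have n1 : - `|F0| <= F0 := lerNnormlW (lexx _).
have n2 : x0 <= `|x0| by exact: ler_norm.
have n3 : (C2 * x0 * y + D + 1) / C1 <= (C2 * `|x0| + D + 1) / C1 * (1 + y).
  rewrite [leRHS]mulrAC ler_pM2r ?invr_gt0//.
  have : C2 * x0 * y <= C2 * `|x0| * y by rewrite ler_wpM2r// ler_wpM2l.
  have : 0 <= C2 * `|x0| by rewrite mulr_ge0.
  move: (C2 * `|x0|) (C2 * x0 * y) => u v; nra.
move: n3; move: ((C2 * x0 * y + D + 1) / C1) ((C2 * `|x0| + D + 1) / C1) => u v n3.
have := normr_ge0 F0; have := normr_ge0 x0.
move: n1 n2; move: (`|F0|) (`|x0|) => f z.
nra.
Qed.

Section oscillation.
Context {R : realType}.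
Implicit Types (p q t s u z a b alpha beta gam M : R) (f g w x F : R -> R).

Lemma rl_causal p f : 0 <= p -> causal f -> causal (rl p f).
Proof.
move=> p0 cf; have [->|pn0] := eqVneq p 0.
  by rewrite (_ : rl 0 f = f)//; apply/funext => s; rewrite /rl eqxx.
rewrite (_ : rl p f = fun s => (Gamma p)^-1 * conv p f s).
  by apply: causalZ; apply: conv_causal => //; rewrite lt_def pn0.
by apply/funext => s; rewrite /rl (negbTE pn0).
Qed.

(** Applying the fractional integral of order alpha to the integrated equation
    turns x and F into ordinary primitives and leaves integrals of orders
    1 + alpha - beta and 1 + alpha of x, to which the monotonicity of kernels of
    order above 1 applies. *)
Lemma inverted_equation alpha beta a b x F :
  0 < beta -> beta < alpha -> alpha <= 1 -> 0 < a -> 0 < b ->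
  {within `[0, +oo[, continuous x} -> {within `[0, +oo[, continuous F} ->
  (forall t, rl (1 - alpha) (incr x) t + a * rl (1 - beta) (incr x) t +
    b * conv 1 (ext x) t = rl (1 - alpha) (incr F) t) ->
  exists C1 C2 C3, [/\ 0 < C1, 0 <= C2, 0 <= C3 &
  forall t, C1 * conv 1 (incr x) t + C2 * conv (1 + (alpha - beta)) (incr x) t +
    C3 * conv (1 + alpha) (ext x) t = C1 * conv 1 (incr F) t].
Proof.
move=> beta0 ba a1 a0 b0 cx cF E.
have al0 : 0 < alpha by exact: lt_trans ba.
have al : 0 < alpha <= 1 by rewrite al0.
have be1 : 0 < 1 - beta < 1 by apply/andP; split; lra.
have one : 0 < (1 : R) <= 1 by rewrite ltr01 lexx.
have [C1 C10 H1] := conv_rl_compl al.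
have [C2 C20 H2] := conv_rl al be1.
have B1 := Beta_ge1 al one.
exists C1, (a * C2), (b * Beta alpha 1); split => //.
- by rewrite mulr_ge0// ltW.
- by rewrite mulr_ge0 ?(ltW b0)// (le_trans ler01).
move=> t; have cX := incr_causal cx; have cXF := incr_causal cF.
have ce := ext_causal cx.
have p0 : 0 <= 1 - alpha by lra.
have q0 : 0 <= 1 - beta by lra.
have r1 := rl_causal p0 cX; have r2 := causalZ a (rl_causal q0 cX).
have r3 := causalZ b (conv_causal ltr01 ce).
have r12 := causalD r1 r2.
rewrite -(H1 _ _ cXF) -(H1 _ _ cX).
have <- : (fun s => rl (1 - alpha) (incr x) s + a * rl (1 - beta) (incr x) s +
    b * conv 1 (ext x) s) = rl (1 - alpha) (incr F) by apply/funext => s; exact: E.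
rewrite (convD _ al0 r12 r3) (convD _ al0 r1 r2).
rewrite (convZ _ _ al0 (rl_causal q0 cX)) (convZ _ _ al0 (conv_causal ltr01 ce)).
rewrite (H2 _ _ cX) (conv_conv _ al0 ltr01 ce) !mulrA.
by rewrite (_ : alpha + (1 - beta) = 1 + (alpha - beta)) ?(addrC alpha 1)//; ring.
Qed.

(** By the inverted equation, a primitive of F - x, corrected by a multiple of
    t^(1 + alpha - beta) coming from x(0), is a nonnegative combination of
    integrals of x of order above 1. These are nondecreasing up to a linear term
    once x is nonnegative, so the derivative, F - x plus O(1 + t^(alpha - beta)),
    is bounded below, and x >= 0 can be dropped. *)
Lemma forcing_lower_bound alpha beta a b x F T :
  0 < beta -> beta < alpha -> alpha <= 1 -> 0 < a -> 0 < b ->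
  {within `[0, +oo[, continuous x} -> {within `[0, +oo[, continuous F} ->
  (forall t, rl (1 - alpha) (incr x) t + a * rl (1 - beta) (incr x) t +
    b * conv 1 (ext x) t = rl (1 - alpha) (incr F) t) ->
  0 <= T -> (forall s, T <= s -> 0 <= x s) ->
  exists2 C, 0 <= C & forall t, T + 1 < t -> - (C * (1 + t `^ (alpha - beta))) <= F t.
Proof.
move=> beta0 ba a1 a0 b0 cx cF E T0 xT.
have [C1 [C2 [C3 [C10 C20 C30 H]]]] := inverted_equation beta0 ba a1 a0 b0 cx cF E.
have al0 : 0 < alpha by exact: lt_trans ba.
have th : 0 < alpha - beta <= 1 by apply/andP; split; lra.
have al : 0 < alpha <= 1 by rewrite al0.
move: H; set theta := alpha - beta in th * => H; have /andP[th0 th1] := th.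
have ce := ext_causal cx; have cX := incr_causal cx; have cXF := incr_causal cF.
have [M M0 xM] := causal_bound T ce.
have xeT s : T <= s -> 0 <= ext x s.
  by move=> Ts; rewrite ext_ge0 ?xT// (le_trans T0).
have q0 : 0 < 1 + theta by rewrite addr_gt0.
(* The rate at which the values of x before T can make the integrals decrease;
   D + 1 instead of D makes Q strictly increasing. *)
pose D := (C2 + C3) * (M * (T + 1)).
have D0 : 0 <= D by rewrite !mulr_ge0// addr_ge0.
pose Q t := C1 * conv 1 (incr F) t + (- C1) * conv 1 (incr x) t +
  (C2 * x 0 / (1 + theta)) * t `^ (1 + theta) - (- (D + 1)) * t.
have QE t : 0 <= t -> Q t = C2 * conv (1 + theta) (ext x) t + C3 * conv (1 + alpha) (ext x) t + (D + 1) * t.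
  move=> t0; rewrite /Q -H incr_add.
  have c1 := ext1_causal (R := R).
  rewrite (convD _ q0 cX (causalZ (x 0) c1)) (convZ _ _ q0 c1) conv_unit//.
  by field; exact: lt0r_neq0.
have Qmono t1 t2 : T + 1 < t1 -> t1 < t2 -> Q t1 < Q t2.
  move=> Tt1 t12.
  have t10 : 0 <= t1 by rewrite (le_trans _ (ltW Tt1))// addr_ge0.
  have t20 : 0 <= t2 by rewrite (le_trans t10)// ltW.
  rewrite !QE//.
  have h1 := conv_nonneg_tail th ce T0 xeT M0 xM (ltW Tt1) (ltW t12).
  have h2 := conv_nonneg_tail al ce T0 xeT M0 xM (ltW Tt1) (ltW t12).
  have h3 := ler_wpM2l C20 h1; have h4 := ler_wpM2l C30 h2.
  rewrite (mulrDr C2) in h3; rewrite (mulrDr C3) in h4.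
  exact: mono_combine h3 h4 t12.
have dQ t : 0 < t -> is_derive (t : R) 1 Q (C1 * incr F t + (- C1) * incr x t +
    (C2 * x 0 / (1 + theta)) * ((1 + theta) * t `^ (1 + theta - 1)) - (- (D + 1)) * 1).
  move=> t0; have h1 := is_derive_conv1_incr t cF; have h2 := is_derive_conv1_incr t cx.
  have h3 := is_derive1_powR (1 + theta) t0.
  exact: (is_deriveB (is_deriveD (is_deriveD (is_deriveZ C1 h1) (is_deriveZ (- C1) h2))
    (is_deriveZ (C2 * x 0 / (1 + theta)) h3)) (is_deriveZ (- (D + 1)) (is_derive_id _ _))).
pose C := `|F 0| + `|x 0| + (C2 * `|x 0| + D + 1) / C1.
exists C.
  by rewrite !addr_ge0// divr_ge0 ?(ltW C10)// !addr_ge0// mulr_ge0.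
move=> t Tt.
have t0 : 0 < t by rewrite (lt_trans _ Tt)// ltr_wpDl.
have : 0 <= Q^`()%classic t.
  apply: (@incr_derive1_ge0_itvy R Q false (T + 1)).
  - move=> y; rewrite inE/= in_itv/= andbT => Ty.
    have y0 : 0 < y by rewrite (lt_trans _ Ty)// ltr_wpDl.
    by have [] := dQ y y0.
  - move=> y z; rewrite !in_itv/= !andbT => Ty Tz yz; exact: Qmono.
  - by rewrite in_itv/= andbT.
rewrite derive1E; have [_ ->] := dQ t t0.
rewrite (_ : 1 + theta - 1 = theta); last by ring.
rewrite /incr !ext_ge0 ?(ltW t0)//.
have xt : 0 <= x t by apply: xT; rewrite (le_trans _ (ltW Tt))// lerDl.
have tt0 : 0 <= t `^ theta by exact: powR_ge0.
exact: lower_bound_algebra.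
Qed.

End oscillation.

(** * From the hypotheses on h to bounds on the forcing, and the theorem *)

Section hypotheses.
Context {R : realType}.
Implicit Types (t s u z a b alpha beta : R) (f g w x F h dh : R -> R).

Lemma is_derive_halfline h dh t : derivative_on_halfline h dh -> 0 < t ->
  is_derive (t : R) 1 h (dh t).
Proof.
move=> H t0; have /cvgrPdist_lt Ht := H t (ltW t0).
have cv : e^-1 *: (h (e *: 1 + t) - h t) @[e --> 0^'] --> dh t.
  apply/cvgrPdist_lt => eps eps0.
  have := Ht eps eps0.
  move=> [d /= d0 Hd].
  exists (Num.min d t); first by rewrite /= lt_min d0.
  move=> e /=; rewrite sub0r normrN lt_min => /andP[ed et] e0.
  have := Hd (e + t); rewrite /= opprD addrCA subrr addr0 normrN => /(_ ed).
  have es : e + t != t by rewrite -subr_eq0 addrK.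
  have et0 : 0 <= e + t.
    by move: et; rewrite ltr_norml => /andP[+ _]; rewrite ltrNl -subr_gt0 opprK addrC => /ltW.
  rewrite in_itv/= andbT => /(_ es et0).
  by rewrite addrK -[e *: 1]/(e * 1) mulr1 mulrC.
apply: DeriveDef; first by apply/cvg_ex; exists (dh t).
exact: cvg_lim.
Qed.

Lemma halfline_bounded h : [bounded h t | t in `[0, +oo[] ->
  exists2 B, 0 <= B & forall t, 0 <= t -> `|h t| <= B.
Proof.
move=> [M [_ hM]]; exists (Num.max 0 (M + 1)); first by rewrite le_max lexx.
move=> t t0; rewrite le_max (hM (M + 1)) ?orbT ?ltrDl//.
by rewrite /= in_itv/= t0.
Qed.

(** The asymptotic bound becomes a global one because a continuous function is
    bounded before any threshold, and passing from t to 1 + t costs a factor 2 in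
    the argument of the power. *)
Lemma bigO_power_bound f r : r <= 0 -> {within `[0, +oo[, continuous f} ->
  f =O_ (pinfty_nbhs R) (fun t : R => t `^ r) ->
  exists2 C, 0 <= C & forall t, 0 <= t -> `|f t| <= C * (1 + t) `^ r.
Proof.
move=> r0 cf /eqOP[k [_ Hk]].
pose k1 := Num.max 1 (k + 1).
have k10 : 0 <= k1 by rewrite le_max ler01.
have kk1 : k < k1 by rewrite lt_max ltrDl ltr01 orbT.
have [T [_ HT]] := Hk k1 kk1.
pose T1 := Num.max 1 (T + 1).
have T11 : 1 <= T1 by rewrite le_max lexx.
have TT1 : T < T1 by rewrite lt_max ltrDl ltr01 orbT.
have ce := ext_causal cf.
have [M M0 fM] := causal_bound T1 ce.
pose C := k1 * 2^-1 `^ r + M * (1 + T1) `^ (- r).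
have T10 : 0 <= 1 + T1 by rewrite addr_ge0// (le_trans ler01).
exists C; first by rewrite addr_ge0// mulr_ge0// powR_ge0.
move=> t t0; have t1 : 0 < 1 + t by rewrite ltr_wpDr.
rewrite /C mulrDl; have [tT|Tt] := leP t T1.
  rewrite ler_wpDl//; first by rewrite !mulr_ge0// powR_ge0.
  apply: (@le_trans _ _ M); first by rewrite -(ext_ge0 f t0) fM.
  rewrite -mulrA ler_peMr// powRN mulrC ler_pdivlMr ?powR_gt0 ?ltr_wpDr ?(le_trans ler01)// mul1r.
  by apply: powR_le_neg => //; rewrite lerD2l.
rewrite ler_wpDr//; first by rewrite !mulr_ge0// powR_ge0.
apply: le_trans (HT t (lt_trans TT1 Tt)) _.
rewrite -mulrA ler_wpM2l// ger0_norm ?powR_ge0// -powRM ?(ltW t1)//.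
have t1' : 1 <= t by rewrite (le_trans T11)// ltW.
by apply: powR_le_neg => //; [rewrite mulr_gt0|lra].
Qed.

(** The product rule gives the terms (1 + t)^sigma h', of order sigma + eta, and
    h (1 + t)^(sigma - 1), which is smaller because eta > -1. *)
Lemma forcing_derivative sigma eta h dh : 0 < sigma -> -1 < eta -> eta <= 0 ->
  derivative_on_halfline h dh -> {within `[0, +oo[, continuous dh} ->
  [bounded h t | t in `[0, +oo[] ->
  dh =O_ (pinfty_nbhs R) (fun t : R => t `^ eta) ->
  exists2 dF : R -> R,
    (forall t, 0 < t -> is_derive (t : R) 1 (fun s => (s + 1) `^ sigma * h s) (dF t)) &
    exists2 C, 0 <= C & forall t, 0 < t -> `|dF t| <= C * (1 + t) `^ (sigma + eta).
Proof.
move=> s0 e1 e0 Hh cdh bh Oh.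
have [B B0 hB] := halfline_bounded bh.
have [C C0 hC] := bigO_power_bound e0 cdh Oh.
exists (fun t => (1 + t) `^ sigma * dh t + h t * (sigma * (1 + t) `^ (sigma - 1))).
  move=> t t0.
  have h1 : is_derive (t : R) 1 (fun s => (1 + s) `^ sigma) (sigma * (1 + t) `^ (sigma - 1)).
    by apply: is_derive_shifted_power; rewrite (lt_trans _ t0)// oppr_lt0.
  have h2 := is_derive_halfline Hh t0.
  have -> : (fun s => (s + 1) `^ sigma * h s) = (fun s => (1 + s) `^ sigma) * h.
    by apply/funext => s; rewrite addrC.
  exact: (is_deriveM h1 h2).
exists (C + B * sigma); first by rewrite addr_ge0// mulr_ge0// ltW.
move=> t t0; have t1 : 0 < 1 + t by rewrite addr_gt0.
have t10 : 1 + t != 0 by rewrite gt_eqF.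
apply: le_trans (ler_normD _ _) _; rewrite mulrDl; apply: lerD.
  rewrite normrM ger0_norm ?powR_ge0// [(1 + t) `^ (sigma + eta)]powRD ?t10 ?implybT//.
  by rewrite mulrCA ler_wpM2l ?powR_ge0// hC// ltW.
rewrite !normrM (gtr0_norm s0) (ger0_norm (powR_ge0 _ _)) mulrA.
apply: ler_pM; rewrite ?mulr_ge0 ?powR_ge0 ?(ltW s0)//.
  by rewrite ler_wpM2r ?(ltW s0)// hB// ltW.
by apply: ler_powR; [rewrite lerDl ltW|rewrite lerD2l ltW].
Qed.

Lemma limf_esup_le0 h : (forall e, 0 < e -> \forall t \near +oo, h t <= e) ->
  (limf_esup (EFin \o h) (pinfty_nbhs R) <= 0)%E.
Proof.
move=> H; apply/lee_addgt0Pr => e e0; rewrite add0e.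
apply: (@le_trans _ _ (ereal_sup ((EFin \o h) @` [set t | h t <= e]))).
  by apply: ereal_inf_lbound; exists [set t | h t <= e] => //; exact: H.
by apply: ge_ereal_sup => _ [t /= ht <-]; rewrite lee_fin.
Qed.

Lemma limf_einf_ge0 h : (forall e, 0 < e -> \forall t \near +oo, - e <= h t) ->
  (0 <= limf_einf (EFin \o h) (pinfty_nbhs R))%E.
Proof.
move=> H; rewrite /limf_einf oppe_ge0.
have -> : (\- (EFin \o h))%E = EFin \o (fun t => - h t) by [].
apply: limf_esup_le0 => e /H; apply: filterS => t; by rewrite lerNl.
Qed.

(** Dividing by (t + 1)^sigma turns the bound into a negative power of t, as
    theta < sigma. *)
Lemma slow_lower_bound C T sigma theta h : 0 <= C -> 0 < theta -> theta < sigma ->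
  (forall t, T < t -> - (C * (1 + t `^ theta)) <= (t + 1) `^ sigma * h t) ->
  forall e, 0 < e -> \forall t \near +oo, - e <= h t.
Proof.
move=> C0 th0 ths H e e0.
have d0 : 0 < sigma - theta by rewrite subr_gt0.
have C20 : 0 <= 2 * C by rewrite mulr_ge0.
have [M M1 HM] := negative_power_small d0 C20 e0.
near=> t.
have Tt : T < t by near: t; apply: nbhs_pinfty_gt; exact: num_real.
have Mt : M < t by near: t; apply: nbhs_pinfty_gt; exact: num_real.
have M0 : 0 < M by exact: lt_le_trans M1.
have t0 : 0 < t by exact: lt_trans Mt.
have t1 : 0 < t + 1 by rewrite addr_gt0.
have t1n : t + 1 != 0 by rewrite gt_eqF.
rewrite -(ler_pM2l (powR_gt0 sigma t1)).
apply: le_trans (H t Tt); rewrite mulrN lerN2.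
apply: (@le_trans _ _ (2 * C * (t + 1) `^ theta)).
  rewrite -mulrA mulrCA ler_wpM2l// mulr_natl mulr2n; apply: lerD.
    rewrite -[leLHS](powRr0 (t + 1)); apply: ler_powR; last exact: ltW.
    by rewrite lerDr ltW.
  by rewrite ge0_ler_powR ?nnegrE ?(ltW th0) ?(ltW t0) ?(ltW t1)// lerDl.
rewrite (_ : theta = sigma + - (sigma - theta)); last by ring.
rewrite [(t + 1) `^ (sigma + _)]powRD ?t1n ?implybT// mulrCA ler_pM2l ?powR_gt0//.
apply: le_trans (HM _ (lexx _)); rewrite ler_wpM2l//.
apply: powR_le_neg => //; first by rewrite (le_trans (ltW Mt))// lerDl.
by rewrite oppr_le0 ltW.
Unshelve. all: by end_near. Qed.

(** The equation is linear, so the case of an eventually negative solution is the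
    positive case for - x and - F. *)
Lemma integrated_equationN alpha beta a b x F : alpha <= 1 -> beta <= 1 ->
  {within `[0, +oo[, continuous x} -> {within `[0, +oo[, continuous F} ->
  (forall t, rl (1 - alpha) (incr x) t + a * rl (1 - beta) (incr x) t +
    b * conv 1 (ext x) t = rl (1 - alpha) (incr F) t) ->
  forall t, rl (1 - alpha) (incr (fun s => -1 * x s)) t +
    a * rl (1 - beta) (incr (fun s => -1 * x s)) t +
    b * conv 1 (ext (fun s => -1 * x s)) t = rl (1 - alpha) (incr (fun s => -1 * F s)) t.
Proof.
move=> a1 b1 cx cF E t.
have iN y : incr (fun s => -1 * y s) = fun s => -1 * incr y s.
  by apply/funext => s; rewrite /incr /ext; case: ifP => _; rewrite ?mulr0// mulrBr.
have eN : ext (fun s => -1 * x s) = fun s => -1 * ext x s.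
  by apply/funext => s; rewrite /ext; case: ifP => _; rewrite ?mulr0.
have p0 : 0 <= 1 - alpha by rewrite subr_ge0.
have q0 : 0 <= 1 - beta by rewrite subr_ge0.
have cX := incr_causal cx; have cXF := incr_causal cF; have ce := ext_causal cx.
rewrite !iN eN (rlZ _ _ p0 cX) (rlZ _ _ q0 cX) (rlZ _ _ p0 cXF) (convZ _ _ ltr01 ce) -E.
by move: (rl _ _ t) (rl _ _ t) (conv 1 _ t) => u v w; ring.
Qed.

Lemma nonvanishing_sign x T : {within `[0, +oo[, continuous x} -> 0 <= T ->
  (forall t, T <= t -> x t != 0) ->
  (forall t, T <= t -> 0 <= x t) \/ (forall t, T <= t -> 0 <= -1 * x t).
Proof.
move=> cx T0 xn.
have noswitch t : T <= t -> 0 <= x T * x t.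
  move=> Tt; rewrite leNgt; apply/negP => neg.
  have [|c] := @IVT R x T t 0 Tt (within0y_seg cx T0).
    rewrite ge_min le_max; move: neg.
    have [xT|xT] := leP (x T) 0.
      by have [xt|xt] := leP (x t) 0; rewrite ?(ltW xt) ?orbT//; nra.
    by have [xt|xt] := leP (x t) 0; rewrite ?(ltW xT) ?orbT//; nra.
  by rewrite in_itv/= => /andP[Tc _] /eqP; apply/negP/xn.
have := xn T (lexx T); rewrite neq_lt => /orP[xT|xT]; [right|left] => t /noswitch.
  by rewrite mulN1r oppr_ge0 nmulr_rge0.
by rewrite pmulr_rge0.
Qed.

Lemma not_oscillatory_nonvanishing x : ~ oscillatory x ->
  exists2 T, 0 <= T & forall t, T <= t -> x t != 0.
Proof.
move=> nosc; apply: contrapT => nT; apply: nosc.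
have Z (k : nat) : exists t : R, k%:R <= t /\ x t = 0.
  apply: contrapT => nt; apply: nT; exists k%:R => // t kt.
  by apply/eqP => xt; apply: nt; exists t.
have [u Hu] := choice Z.
exists u; split => [k||k].
- by have [ku _] := Hu k; rewrite (le_trans _ ku).
- apply/cvgryPge => A; near=> k.
  have [ku _] := Hu k; apply: le_trans ku.
  by near: k; exact: nbhs_infty_ger.
- by have [] := Hu k.
Unshelve. all: by end_near. Qed.

End hypotheses.

Unset Implicit Arguments.

Theorem theorem4p4 (R : realType) (alpha beta sigma eta a b x0 : R)
    (g h dh x : R -> R)
    (hbeta : 0 < beta) (hbeta_alpha : beta < alpha) (halpha : alpha <= 1)
    (ha : 0 < a) (hb : 0 < b)
    (hsigma : alpha - beta < sigma) (hsigma_alpha : sigma < alpha)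
    (hdh : derivative_on_halfline h dh)
    (hdh_cont : {within `[0, +oo[, continuous dh})
    (hbounded : [bounded h t | t in `[0, +oo[])
    (hlimsup : (0 < limf_esup (EFin \o h) (pinfty_nbhs R))%E)
    (hliminf : (limf_einf (EFin \o h) (pinfty_nbhs R) < 0)%E)
    (heta : -1 < eta) (heta_lt : eta < alpha - sigma - 1)
    (hdh_bigO : dh =O_ (pinfty_nbhs R) (fun t : R => t `^ eta))
    (hg_cont : {within `[0, +oo[, continuous g})
    (hF : cont_caputo_diff alpha (fun t => (t + 1) `^ sigma * h t))
    (hg : forall t, 0 <= t ->
        g t = caputo alpha (fun s => (s + 1) `^ sigma * h s) t)
    (hx : is_solution alpha beta a b x0 g x)
    (hx_nontrivial : exists t, 0 <= t /\ x t != 0) :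
  oscillatory x /\
  x =O_ (pinfty_nbhs R)
    (fun t : R => t `^ Num.max (- beta) (eta + sigma - alpha + 1)).
Proof.
pose F := fun s : R => (s + 1) `^ sigma * h s.
have E := integrated_equation hbeta hbeta_alpha halpha hx hF hg.
rewrite -/F in E hF.
have [[cx _ _] _ _] := hx; have [cF _ _] := hF.
have sigma0 : 0 < sigma by lra.
have eta0 : eta <= 0 by lra.
split.
  apply: contrapT => /not_oscillatory_nonvanishing[T T0 xn].
  have th0 : 0 < alpha - beta by rewrite subr_gt0.
  have [xT|xT] := nonvanishing_sign cx T0 xn.
    have [C C0 HC] := forcing_lower_bound hbeta hbeta_alpha halpha ha hb cx cF E T0 xT.
    have := limf_einf_ge0 (slow_lower_bound C0 th0 hsigma HC).
    by rewrite leNgt hliminf.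
  have cxN := within_cst_mul (k := -1) cx; have cFN := within_cst_mul (k := -1) cF.
  have EN := integrated_equationN halpha (ltW (lt_le_trans hbeta_alpha halpha)) cx cF E.
  have [C C0 HC] := forcing_lower_bound hbeta hbeta_alpha halpha ha hb cxN cFN EN T0 xT.
  have HC' t : T + 1 < t -> - (C * (1 + t `^ (alpha - beta))) <= (t + 1) `^ sigma * (- h t).
    by move=> /HC; rewrite mulrN mulN1r.
  have : (limf_esup (EFin \o h) (pinfty_nbhs R) <= 0)%E.
    apply: limf_esup_le0 => e e0.
    have := slow_lower_bound C0 th0 hsigma HC' e0.
    by apply: filterS => t; rewrite lerN2.
  by rewrite leNgt hlimsup.
pose gam := - (eta + sigma - alpha + 1).
have gam0 : 0 < gam by rewrite /gam; lra.
have gamb : gam < beta by rewrite /gam; lra.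
have -> : Num.max (- beta) (eta + sigma - alpha + 1) = - gam.
  by rewrite /gam opprK; apply: max_r; lra.
have [dF HdF [C C0 HC]] := forcing_derivative sigma0 heta eta0 hdh hdh_cont hbounded hdh_bigO.
have se : sigma + eta = - (1 - alpha + gam) by rewrite /gam; ring.
have se0 : - (1 - alpha + gam) <= 0 by rewrite oppr_le0; lra.
rewrite se in HC.
have C20 : 0 <= C * 2^-1 `^ (- (1 - alpha + gam)) by rewrite mulr_ge0 ?powR_ge0.
have HF e s : 0 < e <= 1 -> 0 <= s -> `|incr F s - incr F (s - e)| <=
    e * (C * 2^-1 `^ (- (1 - alpha + gam)) * (1 + s) `^ (- (1 - alpha + gam))).
  exact: incr_diff_le cF HdF C0 se0 HC.
have [K [M [K0 M0 HK]]] := solution_decay hbeta hbeta_alpha halpha ha hb gam0 gamb cx cF C20 HF E.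
apply/eqOP; near=> k; near=> t.
have t0 : 0 < t by near: t; apply: nbhs_pinfty_gt; exact: num_real.
apply: le_trans (HK t (ltW t0)) _; rewrite ger0_norm ?powR_ge0//.
apply: ler_pM; rewrite ?powR_ge0//.
apply: powR_le_neg => //; first by rewrite lerDr ltW.
by rewrite oppr_le0 ltW.
Unshelve. all: by end_near. Qed.
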